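(* Let $n\ge1$. As maps on Dyck paths of size $n$, $$\widehat{RSK}\circ\delta=\partial^{-1}\circ\widehat{RSK},$$ where $\delta$ is rowmotion and $\partial$ is promotion.
   Context: A Dyck path of size $n$ is a lattice path from $(0,0)$ to $(n,n)$ with steps $U=(0,1)$, $R=(1,0)$, weakly above $y=x$, identified with its word of length $2n$. Promotion: the toggle $t_i$ ($1\le i\le 2n-1$) exchanges the $i$-th and $(i+1)$-st letters of the word if the result is a Dyck path and otherwise fixes the path; $\partial=t_{2n-1}\cdots t_2t_1$ ($t_1$ applied first). Rowmotion: let $\mathcal B(n)$ be the poset of unit boxes lying above the lowest path $(UR)^n$ and below the top path $U^nR^n$, where a box is larger the further up and/or to the left it is (covers: the box immediately above, and the box immediately to the left). A Dyck path $p$ corresponds to the order filter $F(p)$ of the boxes above $p$. The rowmotion $\delta$ sends $p$ to the path whose filter is the complement in $\mathcal B(n)$ of the order ideal generated by the minimal elements of $F(p)$. $\widehat{RSK}$ on Dyck paths: for a $321$-avoiding permutation $w\in S_n$ let $p(w)$ be the Dyck path whose peaks (corners $UR$) are exactly the points $(i-1,w_i)$ with $w_i\ge i$ (a bijection from $321$-avoiding permutations to Dyck paths). Let $(A,B)$ be the (insertion, recording) tableau pair of $w$ under Robinson--Schensted row insertion (at most two rows). $\widehat{RSK}(p(w))$ is the Dyck path whose $i$-th step ($1\le i\le n$) is $U$ if $i$ is in the first row of $A$ and $R$ if in the second, and whose $(2n+1-i)$-th step is $R$ if $i$ is in the first row of $B$ and $U$ if in the second. *)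

(* Defs.v *)
From HB Require Import structures.
From mathcomp Require Import all_boot.
From mathcomp Require Import perm.
Set Implicit Arguments.
Unset Strict Implicit.
Unset Printing Implicit Defensive.

(** * Dyck paths *)

(* A step is a boolean: the step up (0,1) is [true], the step right (1,0) is
   [false]. *)
Notation stepU := true (only parsing).
Notation stepR := false (only parsing).

(* The lattice point reached from (0,0) after the first k steps of s. *)
Definition point (s : seq bool) (k : nat) : nat * nat :=
  (count_mem stepR (take k s), count_mem stepU (take k s)).

Definition is_dyck (n : nat) (s : seq bool) : bool :=
  (point s (size s) == (n, n)) &&
  all (fun k => (point s k).1 <= (point s k).2) (iota 0 (size s).+1).

Record dyck (n : nat) : Type := Dyck {
  dyck_word :> n.*2.-tuple bool;
  dyck_wordP : is_dyck n dyck_word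
}.

HB.instance Definition _ n := [isSub for @dyck_word n].
HB.instance Definition _ n := [Finite of dyck n by <:].

(** * Promotion *)

(* The letters of a word are numbered from 1, as in t_i, so the i-th and
   (i+1)-st letters have the 0-based indices i.-1 and i. *)
Definition swap_index (i j : nat) : nat :=
  if j == i.-1 then i else if j == i then i.-1 else j.

Definition swap_letters (n : nat) (i : nat) (s : n.-tuple bool) :
    n.-tuple bool :=
  [tuple nth stepR s (swap_index i j) | j < n].

(* [insubd p s] is s if s is a Dyck path, and p otherwise. *)
Definition toggle (n : nat) (i : nat) (p : dyck n) : dyck n :=
  insubd p (swap_letters i p).

Definition promotion (n : nat) (p : dyck n) : dyck n :=
  foldl (fun q i => toggle i q) p (iota 1 n.*2.-1).

Lemma swap_lettersK (n i : nat) (s : n.-tuple bool) :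
  i < n -> swap_letters i (swap_letters i s) = s.
Proof.
move=> lt_in; apply: eq_from_tnth => j; rewrite tnth_mktuple.
have lt_sw : swap_index i j < n.
  rewrite /swap_index; case: eqP => // _; case: eqP => // _.
  exact: leq_ltn_trans (leq_pred i) lt_in.
have -> : nth stepR (swap_letters i s) (swap_index i j) =
          tnth (swap_letters i s) (Ordinal lt_sw) by rewrite (tnth_nth stepR).
rewrite tnth_mktuple /= (tnth_nth stepR); congr nth.
rewrite /swap_index; case: (eqVneq (j : nat) i.-1) => [-> | ne_ji1].
  by rewrite eqxx; case: eqP.
case: (eqVneq (j : nat) i) => [-> | ne_ji]; first by rewrite eqxx.
by rewrite (negPf ne_ji1) (negPf ne_ji).
Qed.

Lemma toggleK (n i : nat) : i < n.*2 -> involutive (@toggle n i).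
Proof.
move=> lt_in p; apply: val_inj; rewrite /toggle !val_insubd.
case: (boolP (is_dyck n (swap_letters i p))) => [_ | /negPf ndyck].
  by rewrite swap_lettersK // (dyck_wordP p).
by rewrite ndyck.
Qed.

Lemma promotion_inj (n : nat) : injective (@promotion n).
Proof.
rewrite /promotion => p q.
have: all (fun i => i < n.*2) (iota 1 n.*2.-1).
  apply/allP => i; rewrite mem_iota add1n => /andP[i_gt0 lt_i].
  by case: (n.*2) lt_i => [|m] //=; case: i i_gt0.
elim: (iota 1 _) p q => [|i r IHr] p q //= /andP[lt_i lt_r] /(IHr _ _ lt_r).
exact: (can_inj (toggleK lt_i)).
Qed.

(** * Rowmotion *)

(* The unit box [x, x+1] x [y, y+1] is represented by its lower left corner
   (x, y); it lies above the path (UR)^n if and only if x < y. *)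
Definition boxes (n : nat) : {set 'I_n * 'I_n} := [set b : 'I_n * 'I_n | b.1 < b.2].

Definition box_le (n : nat) (b c : 'I_n * 'I_n) : bool :=
  (c.1 <= b.1) && (b.2 <= c.2).

(* The box (x, y) lies above p when p crosses the strip between the abscissas
   x and x+1 at height at most y: since p is weakly increasing, this says that
   the points of p of abscissa at most x have height at most y. *)
Definition path_filter (n : nat) (p : dyck n) : {set 'I_n * 'I_n} :=
  [set b in boxes n |
     [forall k : 'I_(n.*2).+1,
        ((point p k).1 <= b.1) ==> ((point p k).2 <= b.2)]].

Definition minimal_boxes (n : nat) (F : {set 'I_n * 'I_n}) :
    {set 'I_n * 'I_n} :=
  [set b in F | [forall c in F, box_le c b ==> (c == b)]].

Definition box_ideal (n : nat) (S : {set 'I_n * 'I_n}) : {set 'I_n * 'I_n} :=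
  [set b in boxes n | [exists c in S, box_le b c]].

(* The path picked exists and is unique, since p |-> path_filter p is a
   bijection from Dyck paths to order filters; the default value p is never
   used. *)
Definition rowmotion (n : nat) (p : dyck n) : dyck n :=
  odflt p [pick q : dyck n | path_filter q ==
             boxes n :\: box_ideal (minimal_boxes (path_filter p))].

(** * Robinson-Schensted insertion *)

(* Tableaux are sequences of rows.  [row_insert x r] is the row r after the
   insertion of x, together with the entry bumped out, if any. *)
Fixpoint row_insert (x : nat) (r : seq nat) : seq nat * option nat :=
  if r is y :: r' then
    if x < y then (x :: r', Some y)
    else let (r'', b) := row_insert x r' in (y :: r'', b)
  else ([:: x], None).

(* The new tableau, together with the (0-based) row of the new cell. *)
Fixpoint tableau_insert (x : nat) (T : seq (seq nat)) : seq (seq nat) * nat :=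
  if T is r :: T' then
    let (r', b) := row_insert x r in
    if b is Some y then
      let (T'', k) := tableau_insert y T' in (r' :: T'', k.+1)
    else (r' :: T', 0)
  else ([:: [:: x]], 0).

Definition add_cell (k i : nat) (T : seq (seq nat)) : seq (seq nat) :=
  set_nth [::] T k (rcons (nth [::] T k) i).

(* The pair (insertion tableau, recording tableau) of a word. *)
Definition RS (s : seq nat) : seq (seq nat) * seq (seq nat) :=
  foldl (fun AB ix => let (A, k) := tableau_insert ix.2 AB.1 in
                      (A, add_cell k ix.1 AB.2))
        ([::], [::]) (zip (iota 1 (size s)) s).

(** * RSK on Dyck paths *)

(* The one-line notation w_1 ... w_n, with values in {1, ..., n}. *)
Definition one_line (n : nat) (w : {perm 'I_n}) : seq nat :=
  [seq (w i).+1 | i <- enum 'I_n].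

Definition avoids321 (n : nat) (w : {perm 'I_n}) : bool :=
  [forall i : 'I_n, forall j : 'I_n, forall k : 'I_n,
     ~~ [&& i < j, j < k, w j < w i & w k < w j]].

Definition peaks (s : seq bool) : seq (nat * nat) :=
  [seq point s k.+1 | k <- iota 0 (size s).-1
                    & (nth stepU s k == stepU) && (nth stepU s k.+1 == stepR)].

Definition excedance_points (s : seq nat) : seq (nat * nat) :=
  [seq (i.-1, nth 0 s i.-1) | i <- iota 1 (size s) & i <= nth 0 s i.-1].

(* [is_path_of_perm w p] says that p = p(w).  Neither list of points has
   repetitions, so [perm_eq] is the equality of the sets of points. *)
Definition is_path_of_perm (n : nat) (w : {perm 'I_n}) (p : dyck n) : bool :=
  perm_eq (peaks p) (excedance_points (one_line w)).

Definition RSK_steps (s : seq nat) : seq bool :=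
  let (A, B) := RS s in
  [seq if i \in nth [::] A 0 then stepU else stepR | i <- iota 1 (size s)] ++
  rev [seq if i \in nth [::] B 0 then stepR else stepU | i <- iota 1 (size s)].

Lemma size_RSK_steps (n : nat) (w : {perm 'I_n}) :
  size (RSK_steps (one_line w)) == n.*2.
Proof.
rewrite /RSK_steps /one_line; case: (RS _) => A B.
have -> : size [seq (w i).+1 | i <- enum 'I_n] = n by rewrite size_map size_enum_ord.
by rewrite size_cat size_rev !size_map !size_iota addnn.
Qed.

Definition RSK_word (n : nat) (w : {perm 'I_n}) : n.*2.-tuple bool :=
  Tuple (size_RSK_steps w).

(* The 321-avoiding permutation w with p = p(w) exists and is unique, and
   [RSK_word w] is a Dyck path because the tableaux of w are standard of the
   same shape; hence the two default values p are never used. *)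
Definition RSKhat (n : nat) (p : dyck n) : dyck n :=
  if [pick w : {perm 'I_n} | avoids321 w && is_path_of_perm w p] is Some w
  then insubd p (RSK_word w) else p.

(* Main.v *)
Require Import Defs.
From mathcomp Require Import all_boot perm.
From mathcomp Require Import zify.
Set Implicit Arguments.
Unset Strict Implicit.
Unset Printing Implicit Defensive.

(** A permutation that avoids 321 is the union of two increasing sequences of
    entries (position, value): the uppers (a_1, b_1), (a_2, b_2), ... with
    a_i <= b_i, and the lowers (c_1, d_1), (c_2, d_2), ... with d_j <= c_j.  In
    row insertion only lowers bump, they bump only uppers, and the bumped uppers
    leave the first row in the order in which they came.  Hence the second rows of
    the two tableaux are read off a greedy matching of the uppers with the
    lowers: the second row of A consists of the matched b_i, and that of B of
    the matched c_j ([RS_greedy_rec], [RSK_steps_greedy]).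

    Let w and w' be the permutations of the paths p and rowmotion p.  The peaks
    of rowmotion p off the lowest path are the valleys of p moved by (-1, 1)
    ([rowmotion_peak]).  So, if the uppers of w are its weak excedances, with
    a_1 = 1 and b_k = n, and if the uppers of w' are its strict excedances,
    then w' has the uppers (a_(i+1) - 1, b_i + 1) and the lowers
    (c_j - 1, d_(j-1) + 1), where d_0 = 0 and c_(m+1) = n + 1.  The greedy
    matching depends only on comparisons of positions with positions and of
    values with values; up to a relabelling one therefore compares the matching
    of the (a_i, b_i) with the (c_j, d_j) and the matching of the
    (a_(i+1), b_i) with the (c_j, d_(j-1)).  Both match the i-th upper with the
    i-th lower, until this fails in one of them; from then on the two differ in
    one pending element, which is passed along to the end ([greedy_pending],
    [greedy_one_flip]).

    Place the values 1, ..., n and then the positions n, ..., 1 around a circle,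
    as the steps of the path do.  The relabelling is a rotation by one place,
    and apart from it exactly one step changes, from U to R: the words W' of
    the image of rowmotion p and W of the image of p are
    W' = U alpha R gamma and W = alpha U gamma R.  All elements before the
    failure are matched, so one of alpha and gamma is balanced, and then alpha
    is ([one_flip_form]).  Promotion carries the first U of W' to the first
    return of the path, leaves it there, and carries the R of the return to the
    end; it maps W' to W ([promotion_word]), and this is the assertion. *)

(** * Dyck words and promotion *)

Definition ballot (s : seq bool) : Prop :=
  forall k, count_mem stepR (take k s) <= count_mem stepU (take k s).

Lemma is_dyckP (n : nat) (s : seq bool) :
  is_dyck n s <-> [/\ count_mem stepU s = n, count_mem stepR s = n & ballot s].
Proof.
rewrite /is_dyck /point take_size; split.
  case/andP=> /eqP[cR cU] /allP bal; split=> // k.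
  have [le_k|lt_k] := leqP k (size s).
    by apply: bal; rewrite mem_iota ltnS.
  by rewrite take_oversize ?cR ?cU // ltnW.
by case=> -> -> bal; rewrite eqxx; apply/allP=> k _; apply: bal.
Qed.

Lemma size_dyck (n : nat) (s : seq bool) : is_dyck n s -> size s = n.*2.
Proof.
move/is_dyckP=> [cU cR _]; rewrite -(count_predC (pred1 stepU)) cU -addnn.
by congr (_ + _); rewrite -[RHS]cR; apply: eq_count; case.
Qed.

Lemma toggle_word (n : nat) (p : dyck n) (u v : seq bool) (x y : bool) :
  p = u ++ [:: x, y & v] :> seq bool ->
  toggle (size u).+1 p =
    (if is_dyck n (u ++ [:: y, x & v]) then u ++ [:: y, x & v] else p) :> seq bool.
Proof.
move=> def_p.
have sw : swap_letters (size u).+1 p = u ++ [:: y, x & v] :> seq bool.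
  have szp := size_tuple (dyck_word p); rewrite def_p size_cat /= in szp.
  apply: (@eq_from_nth _ stepR); first by rewrite size_tuple size_cat /=.
  move=> i; rewrite size_tuple => lt_i.
  rewrite -(tnth_nth _ _ (Ordinal lt_i)) tnth_mktuple /= def_p /swap_index /=.
  case: eqP => [->|ne1]; first by rewrite !nth_cat ltnNge leqnSn /= subSnn ltnn subnn.
  case: eqP => [->|ne2].
    by rewrite !nth_cat ltnn subnn ltnNge leqnSn /= subSnn.
  rewrite !nth_cat; case: ltnP => // le_i.
  by have -> : i - size u = (i - (size u).+2).+2 by lia.
rewrite /toggle val_insubd -sw; case: ifP => _ //.
Qed.

(** The toggles carry the first U to the right.  It can pass every R as long as
    the letters that it leaves behind do not end on the diagonal, so it goes
    through [al] and stops before the next R, whose move would take the path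
    below the diagonal.  The next toggle picks up this R, and an R can always
    move to the end.  Every intermediate word is a Dyck word because its
    prefixes have the same content as prefixes of [p] or of [q]. *)
Lemma promotion_word (n : nat) (p q : dyck n) (al ga : seq bool) :
  p = stepU :: al ++ stepR :: ga :> seq bool ->
  q = al ++ stepU :: ga ++ [:: stepR] :> seq bool ->
  count_mem stepU al = count_mem stepR al ->
  promotion p = q.
Proof.
move=> def_p def_q bal.
have /is_dyckP[pU pR pB] := dyck_wordP p; have /is_dyckP[qU qR qB] := dyck_wordP q.
rewrite def_p /= count_cat /= in pU; rewrite def_p /= count_cat /= in pR.
have sz : n.*2.-1 = size al + (size ga).+1.
  by have := size_tuple (dyck_word p); rewrite def_p /= size_cat /=; lia.
have dy1 al1 al2 : al = al1 ++ al2 ->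
    is_dyck n (al1 ++ stepU :: al2 ++ stepR :: ga).
  move=> def_al; apply/is_dyckP; split.
  - by rewrite count_cat /= count_cat /= -pU def_al count_cat /=; lia.
  - by rewrite count_cat /= count_cat /= -pR def_al count_cat /=; lia.
  move=> k; have [le_k|lt_k] := leqP k (size al1).
    have := qB k; rewrite def_q def_al -!catA.
    by rewrite !(takel_cat _ le_k).
  have := pB k; rewrite def_p def_al -catA.
  have -> : k = (size al1 + (k - (size al1).+1)).+1 by lia.
  set j := k - _; rewrite [take _ (al1 ++ _)]take_cat.
  have -> : (size al1 + j).+1 - size al1 = j.+1 by lia.
  rewrite ltnNge leqW ?leq_addr //= takeD take_size_cat // drop_size_cat //.
  by rewrite !count_cat /= ?count_cat /=; lia.
have dy2 ga1 ga2 : ga = ga1 ++ ga2 ->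
    is_dyck n (al ++ stepU :: ga1 ++ stepR :: ga2).
  move=> def_ga; apply/is_dyckP; split.
  - by rewrite count_cat /= count_cat /= -pU def_ga count_cat /=; lia.
  - by rewrite count_cat /= count_cat /= -pR def_ga count_cat /=; lia.
  move=> k; have [le_k|lt_k] := leqP k (size al + (size ga1).+1).
    have le_k' : k <= size (al ++ stepU :: ga1) by rewrite size_cat.
    have := qB k; rewrite def_q def_ga -!catA -!(cat_cons stepU ga1) !(catA al).
    by rewrite !(takel_cat _ le_k').
  have [j def_k] : exists j, k = size al + (size ga1).+1 + j.+1.
    by exists (k - (size al + (size ga1).+2)); lia.
  have def_k1 : k = size (al ++ stepU :: ga1) + j.+1 by rewrite size_cat.
  have def_k2 : k = size (stepU :: al ++ stepR :: ga1) + j.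
    by rewrite /= size_cat /=; lia.
  have def_p2 : p = (stepU :: al ++ stepR :: ga1) ++ ga2 :> seq bool.
    by rewrite def_p def_ga /= -catA.
  have := pB k; rewrite {1 2}def_k2 def_k1 def_p2 -(cat_cons stepU ga1) (catA al).
  rewrite !takeD !take_size_cat // !drop_size_cat //.
  by rewrite !count_cat /= !count_cat /=; lia.
(* the carried letter is U, and [al1] is behind it *)
have run1 al1 al2 (r : dyck n) : al = al1 ++ al2 ->
    r = al1 ++ stepU :: al2 ++ stepR :: ga :> seq bool ->
    foldl (fun q i => toggle i q) r (iota (size al1).+1 (size al2)) =
      al ++ stepU :: stepR :: ga :> seq bool.
  elim: al2 al1 r => [|x al2 IH] al1 r def_al def_r.
    by rewrite /= def_r def_al cats0.
  rewrite /= -[in iota _ _](size_rcons al1 x); apply: IH; first by rewrite cat_rcons.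
  have dy : is_dyck n (al1 ++ [:: x, stepU & al2 ++ stepR :: ga]).
    by have := dy1 (rcons al1 x) al2; rewrite !cat_rcons => -> //.
  by rewrite (toggle_word def_r) dy cat_rcons.
(* the carried letter is R, and [al], U, [ga1] are behind it *)
have run2 ga1 ga2 (r : dyck n) : ga = ga1 ++ ga2 ->
    r = al ++ stepU :: ga1 ++ stepR :: ga2 :> seq bool ->
    foldl (fun q i => toggle i q) r (iota (size al + (size ga1).+1).+1 (size ga2)) =
      q :> seq bool.
  elim: ga2 ga1 r => [|x ga2 IH] ga1 r def_ga def_r.
    by rewrite /= def_r def_q def_ga cats0.
  rewrite /= -[in iota _ _]addnS -[in iota _ _](size_rcons ga1 x); apply: IH; first by rewrite cat_rcons.
  have dy : is_dyck n ((al ++ stepU :: ga1) ++ [:: x, stepR & ga2]).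
    by have := dy2 (rcons ga1 x) ga2; rewrite !cat_rcons -catA => -> //.
  have := @toggle_word n r (al ++ stepU :: ga1) ga2 stepR x.
  by rewrite -catA def_r => /(_ erefl); rewrite dy size_cat /= cat_rcons -catA.
do 2!apply: val_inj => /=; rewrite /promotion sz iotaD foldl_cat.
set r := foldl _ p _.
have def_r : r = al ++ stepU :: stepR :: ga :> seq bool.
  by apply: (@run1 [::] al).
rewrite /= addnC; apply: (run2 [::] ga) => //=.
  rewrite addn1 (toggle_word def_r) ifN ?def_r //.
  apply/negP=> /is_dyckP[_ _ /(_ (size al).+1)].
  by rewrite -addn1 takeD take_size_cat // drop_size_cat // !count_cat /= bal ?take0 /=; lia.
Qed.

(** * Greedy matching of two sequences of entries *)

(** A pair (position, value) of a permutation. *)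
Definition entry : Type := (nat * nat)%type.

(** Both arguments are increasing in position and in value.  An upper [x] and a
    lower [y] may be matched when [x] comes first and has the larger value.
    A lower that comes before the first upper can no longer be matched, nor can
    an upper whose value lies below that of the first lower. *)
Fixpoint greedy (us : seq entry) : seq entry -> seq (entry * entry) :=
  fix greedy_us (ls : seq entry) :=
    match us, ls with
    | x :: us', y :: ls' =>
        if y.1 < x.1 then greedy_us ls'
        else if x.2 < y.2 then greedy us' ls
        else (x, y) :: greedy us' ls'
    | _, _ => [::]
    end.

(** A bump is recorded by the value that leaves the first row and by the
    position at which it leaves. *)
Definition bumped (M : seq (entry * entry)) : seq nat := [seq m.1.2 | m <- M].
Definition bumping (M : seq (entry * entry)) : seq nat := [seq m.2.1 | m <- M].

Lemma greedy_nil (ls : seq entry) : greedy [::] ls = [::].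
Proof. by case: ls. Qed.

Lemma greedy_nil_r (us : seq entry) : greedy us [::] = [::].
Proof. by case: us. Qed.

Lemma greedy_cons x us y ls :
  greedy (x :: us) (y :: ls) =
    if y.1 < x.1 then greedy (x :: us) ls
    else if x.2 < y.2 then greedy us (y :: ls)
    else (x, y) :: greedy us ls.
Proof. by []. Qed.

Arguments greedy : simpl never.

(** The two tests of [greedy] cannot both succeed on the same heads, so that
    their order does not matter. *)
Definition compatible (us ls : seq entry) : Prop :=
  forall x y, x \in us -> y \in ls -> x.1 <= y.1 \/ y.2 <= x.2.

Lemma compatible_sub us ls us' ls' :
  compatible us ls -> {subset us' <= us} -> {subset ls' <= ls} ->
  compatible us' ls'.
Proof. by move=> comp su sl x y /su xu /sl yl; apply: comp. Qed.

Definition opt_seq (e : bool) (x : nat) : seq nat := if e then [:: x] else [::].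

(** The matchings of two pairs of sequences that differ by one pending element.
    In the first part the left side has an additional head position [a] of an
    upper and an additional head position [c] of a lower, which is pending: when
    the left side matches [c] with some value b, the right side matches b with
    a later position c2, and c2 is pending instead.  In the second part the
    right side has an additional head value [b] of an upper and an additional
    head value [d] of a lower, and [b] is pending; when the right side matches
    [b], the situation becomes that of the first part.  At the end a pending
    position is matched with the last value [n], or the pending element is itself
    the last value or the last position; the boolean [e] tells whether [n] or [N]
    makes up the difference. *)
Lemma greedy_pending (n N k : nat) (as_ bs cs ds : seq nat) :
  size as_ + size ds <= k ->
  size bs = (size as_).+1 -> size cs = (size ds).+1 ->
  last 0 bs = n -> last 0 cs = N ->
  sorted leq cs -> all (leq^~ n) ds -> all (leq^~ N) as_ ->
  compatible (zip as_ bs) (zip cs ds) ->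
  (forall a c cs1, cs = c :: cs1 -> a <= c ->
   exists e,
     bumped (greedy (zip (a :: as_) bs) (zip cs ds)) =
       bumped (greedy (zip as_ bs) (zip cs1 ds)) ++ opt_seq e n /\
     c :: bumping (greedy (zip as_ bs) (zip cs1 ds)) =
       bumping (greedy (zip (a :: as_) bs) (zip cs ds)) ++ opt_seq (~~ e) N) /\
  (forall b d bs1, bs = b :: bs1 -> d <= b ->
   exists e,
     b :: bumped (greedy (zip as_ bs1) (zip cs ds)) =
       bumped (greedy (zip as_ bs) (zip cs (d :: ds))) ++ opt_seq e n /\
     bumping (greedy (zip as_ bs) (zip cs (d :: ds))) =
       bumping (greedy (zip as_ bs1) (zip cs ds)) ++ opt_seq (~~ e) N).
Proof.
elim: k as_ bs cs ds => [|k IH] as_ bs cs ds.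
  case: as_ => //; case: ds => // _; case: bs => [|b []] //; case: cs => [|c []] //=.
  move=> _ _ -> -> _ _ _ _; split.
    by move=> a ? ? [<- <-] _; exists false.
  by move=> ? d ? [<- <-] _; exists true.
move=> le_k szb szc lastb lastc cs_sorted ds_le as_le comp; split.
  move=> a c cs1 def_cs le_ac; subst cs.
  case: bs szb lastb comp => [|b bs] // [szb] lastb comp.
  case: as_ le_k szb as_le comp => [|a2 as1] le_k szb as_le comp.
    case: bs szb lastb {comp} => // _ /= ?; subst b.
    case: ds le_k szc ds_le => [|d ds] le_k szc ds_le.
      case: cs1 szc lastc {cs_sorted} => // _ <-.
      by exists false.
    exists true; rewrite /= !greedy_nil greedy_cons /=.
    have [-> ->] : (c < a) = false /\ (n < d) = false by move: ds_le => /=; lia. by rewrite greedy_nil.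
  case: ds le_k szc ds_le comp => [|d ds] le_k szc ds_le comp.
    case: cs1 szc lastc {cs_sorted comp} => // _ /= <-.
    by exists false; rewrite /= ?greedy_nil_r.
  case: cs1 szc cs_sorted lastc comp => [|c2 cs1] // [szc] cs_sorted lastc comp.
  have /andP[le_cc2 cs1_sorted] : (c <= c2) && path leq c2 cs1 by [].
  have comp2 := comp (a2, b) (c, d).
  rewrite /= greedy_cons /= ltnNge le_ac /=.
  case: ltnP => [lt_bd|le_db].
    have le_a2c : a2 <= c by move: comp2; rewrite !inE !eqxx /= leqNgt; lia.
    have [|||||||||HA _] := IH as1 bs (c :: c2 :: cs1) (d :: ds) => //.
    - by rewrite /= szc.
    - by case: (bs) szb lastb.
    - by move: as_le => /= /andP[].
    - by apply: (compatible_sub comp) => // x; rewrite /= inE => ->; rewrite orbT.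
    have [e] := HA a2 c _ erefl le_a2c.
    rewrite /= greedy_cons /=.
    by rewrite ltnNge (leq_trans le_a2c le_cc2) lt_bd /=; exists e.
  have [|||||||||_ HB] := IH (a2 :: as1) (b :: bs) (c2 :: cs1) ds => //.
  - by move: le_k => /=; lia.
  - by rewrite /= szb.
  - by rewrite /= szc.
  - by move: ds_le => /= /andP[].
  - by apply: (compatible_sub comp) => // x; rewrite /= inE => ->; rewrite orbT.
  have [e [eB eC]] := HB b d _ erefl le_db.
  by exists e; rewrite /= eB eC.
move=> b d bs1 def_bs le_db; subst bs; case: szb => szb.
case: as_ le_k szb as_le comp => [|a2 as1] le_k szb as_le comp.
  case: bs1 szb lastb {comp} => // _ /= <-.
  by exists true; rewrite !greedy_nil.
case: cs szc lastc cs_sorted comp => [|c2 cs1] // [szc] lastc cs_sorted comp.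
rewrite /= greedy_cons /=.
case: ltnP => [lt_c2a2|le_a2c2].
  case: ds le_k szc ds_le comp => [|d2 ds] le_k szc ds_le comp.
    case: cs1 szc lastc {comp cs_sorted} => // _ /= def_c2.
    by move: as_le; rewrite /= -def_c2; lia.
  have le_d2b : d2 <= b.
    by have := comp (a2, b) (c2, d2); rewrite !inE !eqxx /=; lia.
  have [||||||||| _ HB] := IH (a2 :: as1) (b :: bs1) cs1 ds => //.
  - by move: le_k => /=; lia.
  - by rewrite /= szb.
  - by case: (cs1) szc lastc.
  - exact: path_sorted cs_sorted.
  - by move: ds_le => /= /andP[].
  - by apply: (compatible_sub comp) => // x; rewrite /= inE => ->; rewrite orbT.
  have [e] := HB b d2 _ erefl le_d2b.
  case: bs1 szb {lastb comp HB} => [|b1 bs1] // szb.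
  rewrite /= greedy_cons /= lt_c2a2.
  by exists e.
rewrite ltnNge le_db /=.
case: bs1 szb lastb comp => [|b1 bs1] // szb lastb comp.
have [||||||||| HA _] := IH as1 (b1 :: bs1) (c2 :: cs1) ds => //.
- by rewrite /= szc.
- by move: as_le => /= /andP[].
- by apply: (compatible_sub comp) => // x; rewrite /= inE => ->; rewrite orbT.
have [e [eB eC]] := HA a2 c2 _ erefl le_a2c2.
by exists e; rewrite /= -eB -eC.
Qed.

(** How the matching of the uppers (a_(i+1), b_i) and the lowers (c_j, d_(j-1))
    (primed) differs from that of the (a_i, b_i) and the (c_j, d_j).  Besides
    the last value [n] and the last position [N], which correspond to each other
    around the circle, one element changes its state: a value [b], a position
    [c], or the last ones themselves.  The data [pb], [pd] and [pc], [pa] record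
    that everything before this element is matched. *)
Inductive one_flip (n N : nat) (as_ bs cs ds OB OC OB' OC' : seq nat) : Prop :=
| FlipValue pb b rb pd rd X e of
    bs = pb ++ b :: rb & rb <> [::] & ds = pd ++ rd & size pd = size pb &
    all (leq^~ b) pd & all (ltn b) rd &
    OB = pb ++ X ++ opt_seq e n & OB' = pb ++ b :: X &
    OC' = OC ++ opt_seq (~~ e) N
| FlipPosition pc c rc pa ra Y e of
    cs = pc ++ c :: rc & rc <> [::] & as_ = pa ++ ra & size pa = size pc &
    all (leq^~ c) pa & all (ltn c) ra &
    OC = pc ++ c :: Y & OC' = pc ++ Y ++ opt_seq (~~ e) N &
    OB = OB' ++ opt_seq e n
| FlipLast of
    bs = rcons OB n & cs = rcons OC N & size bs = (size ds).+1 &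
    size cs = (size as_).+1 & OB' = OB & OC' = OC.

(** While d_i <= b_i and a_(i+1) <= c_i, both sides match the i-th upper with
    the i-th lower.  If d_i <= b_i is the first of these comparisons to fail,
    then c_i is pending on the left; if a_(i+1) <= c_i is, then b_i is pending on
    the right. *)
Lemma greedy_one_flip (n N a d : nat) (as_ bs cs ds : seq nat) :
  size bs = (size as_).+1 -> size cs = (size ds).+1 ->
  last 0 bs = n -> last 0 cs = N ->
  sorted leq bs -> sorted leq cs -> sorted leq as_ -> sorted leq ds ->
  all (leq^~ n) ds -> all (leq^~ N) as_ ->
  compatible (zip as_ bs) (zip cs ds) ->
  a <= head 0 cs -> d <= head 0 bs ->
  let M := greedy (zip (a :: as_) bs) (zip cs ds) in
  let M' := greedy (zip as_ bs) (zip cs (d :: ds)) in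
  one_flip n N as_ bs cs ds (bumped M) (bumping M) (bumped M') (bumping M').
Proof.
elim: bs as_ cs ds a d => [|b bs IH] // as_ [|c cs] // ds a d [szb] [szc].
move=> lastb lastc bs_sorted cs_sorted as_sorted ds_sorted ds_le as_le comp.
rewrite [head _ _]/= [head _ _]/= => le_ac le_db M M'; rewrite {}/M {}/M'.
have lt_ca : (c < a) = false by lia.
have lt_bd : (b < d) = false by lia.
case: as_ szb as_sorted as_le comp => [|a2 as_] szb as_sorted as_le comp.
  case: bs szb lastb {IH bs_sorted comp} => // _ /= ?; subst b.
  case: ds szc ds_sorted ds_le => [|d1 ds] szc ds_sorted ds_le.
    case: cs szc lastc {cs_sorted} => // _ ?; subst N.
    by apply: FlipLast; rewrite /= ?greedy_nil_r ?greedy_nil.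
  have lt_nd : (n < d1) = false by move: ds_le => /=; lia.
  apply: (@FlipPosition _ _ _ _ _ _ _ _ _ _ [::] c cs [::] [::] [::] true) => //.
  - by case: (cs) szc.
  - by rewrite /= greedy_cons /= lt_ca lt_nd ?greedy_nil.
  - by rewrite /= greedy_cons /= lt_ca lt_nd ?greedy_nil.
case: ds szc ds_sorted ds_le comp => [|d1 ds] szc ds_sorted ds_le comp.
  case: cs szc lastc {comp IH cs_sorted} => // _ /= ?; subst c.
  have lt_Na : (N < a2) = false by move: as_le => /=; lia.
  apply: (@FlipValue _ _ _ _ _ _ _ _ _ _ [::] b bs [::] [::] [::] false) => //.
  - by case: (bs) szb.
  - by rewrite /= greedy_cons /= lt_Na lt_bd /= ?greedy_nil_r.
  - by rewrite /= !greedy_cons /= lt_Na lt_bd /= ?greedy_nil_r.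
have comp2 := comp (a2, b) (c, d1).
case: (ltnP b d1) => [lt_bd1|le_d1b].
  have le_a2c : a2 <= c by move: comp2; rewrite !inE !eqxx /=; lia.
  have lt_ca2 : (c < a2) = false by lia.
  have [|||||||||HA _] :=
    @greedy_pending n N (size as_ + size (d1 :: ds)) as_ bs (c :: cs) (d1 :: ds) => //.
  - by rewrite /= szc.
  - by case: (bs) szb lastb.
  - by move: as_le => /= /andP[].
  - by apply: (compatible_sub comp) => // x; rewrite /= inE => ->; rewrite orbT.
  have [e [eB eC]] := HA a2 c _ erefl le_a2c.
  apply: (@FlipValue _ _ _ _ _ _ _ _ _ _ [::] b bs [::] (d1 :: ds) _ e) => //.
  - by case: (bs) szb.
  - rewrite /= lt_bd1 /=; apply/allP=> x x_ds.
    by apply: (leq_trans lt_bd1); apply: (allP (order_path_min leq_trans ds_sorted)).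
  - rewrite /= greedy_cons /= lt_ca lt_bd1; exact: eB.
  - by rewrite /= greedy_cons /= lt_ca2 lt_bd.
  - by rewrite /= !greedy_cons /= lt_ca lt_bd1 lt_ca2 lt_bd.
have lt_bd1 : (b < d1) = false by lia.
case: (ltnP c a2) => [lt_ca2|le_a2c].
  have [|||||||||_ HB] :=
    @greedy_pending n N (size (a2 :: as_) + size ds) (a2 :: as_) (b :: bs) cs ds => //.
  - by rewrite /= szb.
  - by case: (cs) szc lastc.
  - exact: path_sorted cs_sorted.
  - by move: ds_le => /= /andP[].
  - by apply: (compatible_sub comp) => // x; rewrite /= inE => ->; rewrite orbT.
  have [e [eB eC]] := HB b d1 _ erefl le_d1b.
  apply: (@FlipPosition _ _ _ _ _ _ _ _ _ _ [::] c cs [::] (a2 :: as_) _ e) => //.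
  - by case: (cs) szc.
  - rewrite /= lt_ca2 /=; apply/allP=> x x_as.
    by apply: (leq_trans lt_ca2); apply: (allP (order_path_min leq_trans as_sorted)).
  - by rewrite /= greedy_cons /= lt_ca lt_bd1.
  - by rewrite /= greedy_cons /= lt_ca2.
  - by rewrite /= !greedy_cons /= lt_ca lt_bd1 lt_ca2.
have lt_ca2 : (c < a2) = false by lia.
have bs_path : path leq b bs by [].
have cs_path : path leq c cs by [].
have le_bs := allP (order_path_min leq_trans bs_path).
have le_cs := allP (order_path_min leq_trans cs_path).
have defM : greedy (zip [:: a, a2 & as_] (b :: bs)) (zip (c :: cs) (d1 :: ds)) =
    (a, b, (c, d1)) :: greedy (zip (a2 :: as_) bs) (zip cs ds).
  by rewrite /= greedy_cons /= lt_ca lt_bd1.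
have defM' : greedy (zip (a2 :: as_) (b :: bs)) (zip (c :: cs) [:: d, d1 & ds]) =
    (a2, b, (c, d)) :: greedy (zip as_ bs) (zip cs (d1 :: ds)).
  by rewrite /= greedy_cons /= lt_ca2 lt_bd.
rewrite {}defM {}defM'.
have bs_neq0 : bs <> [::] by case: (bs) szb.
have cs_neq0 : cs <> [::] by case: (cs) szc.
case: (IH as_ cs ds a2 d1) => //.
- by case: (bs) bs_neq0 lastb.
- by case: (cs) cs_neq0 lastc.
- exact: path_sorted bs_path.
- exact: path_sorted cs_path.
- exact: path_sorted as_sorted.
- exact: path_sorted ds_sorted.
- by move: ds_le => /= /andP[].
- by move: as_le => /= /andP[].
- by apply: (compatible_sub comp) => x; rewrite /= inE => ->; rewrite orbT.
- by apply: leq_trans (le_cs _ _) => //; case: (cs) cs_neq0 => //= *; rewrite mem_head.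
- by apply: leq_trans (le_bs _ _) => //; case: (bs) bs_neq0 => //= *; rewrite mem_head.
- move=> pb b' rb pd rd X e def_bs nz -> szp le_pd lt_rd eB eB' eC.
  apply: (@FlipValue _ _ _ _ _ _ _ _ _ _ (b :: pb) b' rb (d1 :: pd) rd X e) => //=.
  + by rewrite def_bs.
  + by rewrite szp.
  + rewrite le_pd andbT (leq_trans le_d1b) //; apply: le_bs.
    by rewrite def_bs mem_cat mem_head orbT.
  + by rewrite eB.
  + by rewrite eB'.
  + by rewrite eC.
- move=> pc c' rc pa ra Y e def_cs nz -> szp le_pa lt_ra eC eC' eB.
  apply: (@FlipPosition _ _ _ _ _ _ _ _ _ _ (c :: pc) c' rc (a2 :: pa) ra Y e) => //=.
  + by rewrite def_cs.
  + by rewrite szp.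
  + rewrite le_pa andbT (leq_trans le_a2c) //; apply: le_cs.
    by rewrite def_cs mem_cat mem_head orbT.
  + by rewrite eC.
  + by rewrite eC'.
  + by rewrite eB.
move=> eb ec szb' szc' eB eC; apply: FlipLast => /=.
- by rewrite {1}eb.
- by rewrite {1}ec.
- by rewrite szb'.
- by rewrite szc'.
- by rewrite eB.
by rewrite eC.
Qed.

(** * Row insertion of a union of two increasing sequences *)

Lemma row_insert_rcons (x : nat) (r : seq nat) :
  all (leq^~ x) r -> row_insert x r = (rcons r x, None).
Proof.
by elim: r => //= y r IH /andP[le_yx /IH->]; rewrite ltnNge le_yx.
Qed.

Lemma row_insert_bump (x y : nat) (r1 r2 : seq nat) :
  all (leq^~ x) r1 -> x < y ->
  row_insert x (r1 ++ y :: r2) = (r1 ++ x :: r2, Some y).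
Proof.
move=> + lt_xy; elim: r1 => [|z r1 IH] /=; first by rewrite lt_xy.
by case/andP=> le_zx /IH->; rewrite ltnNge le_zx.
Qed.

Definition two_rows (r1 r2 : seq nat) : seq (seq nat) :=
  if r1 is [::] then [::] else if r2 is [::] then [:: r1] else [:: r1; r2].

Lemma nth_two_rows r1 r2 : nth [::] (two_rows r1 r2) 0 = r1.
Proof. by case: r1; case: r2. Qed.

Lemma insert_row1 (x : nat) (r1 r2 : seq nat) :
  all (leq^~ x) r1 -> (r1 = [::] -> r2 = [::]) ->
  tableau_insert x (two_rows r1 r2) = (two_rows (rcons r1 x) r2, 0).
Proof.
case: r1 => [_ -> //|y r1] le_x _; rewrite /two_rows.
by case: r2 => [|z r2]; rewrite [LHS]/= -[if _ then _ else _]/(row_insert x (y :: r1))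
  (row_insert_rcons le_x).
Qed.

Lemma insert_row2 (x y : nat) (r1 r1' r2 : seq nat) :
  all (leq^~ x) r1 -> x < y -> all (leq^~ y) r2 ->
  tableau_insert x (two_rows (r1 ++ y :: r1') r2) =
    (two_rows (r1 ++ x :: r1') (rcons r2 y), 1).
Proof.
move=> le_x lt_xy le_y.
have -> : two_rows (r1 ++ y :: r1') r2 =
    (r1 ++ y :: r1') :: (if r2 is [::] then [::] else [:: r2]).
  by rewrite /two_rows; case: (r1) (r2) => [|? ?] [|? ?].
rewrite /= row_insert_bump //.
have -> : two_rows (r1 ++ x :: r1') (rcons r2 y) = [:: r1 ++ x :: r1'; rcons r2 y].
  by rewrite /two_rows; case: (r1) (r2) => [|? ?] [|? ?].
by case: r2 le_y => [|z r2] le_y //; rewrite /tableau_insert row_insert_rcons.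
Qed.

Lemma add_cell1 (i : nat) (r1 r2 : seq nat) :
  (r1 = [::] -> r2 = [::]) -> add_cell 0 i (two_rows r1 r2) = two_rows (rcons r1 i) r2.
Proof. by case: r1 => [-> //|y r1]; case: r2. Qed.

Lemma add_cell2 (i : nat) (r1 r2 : seq nat) :
  r1 <> [::] -> add_cell 1 i (two_rows r1 r2) = two_rows r1 (rcons r2 i).
Proof. by case: r1 => // y r1 _; case: r2. Qed.

Definition RS_step (AB : seq (seq nat) * seq (seq nat)) (x : entry) :=
  let (A, k) := tableau_insert x.2 AB.1 in (A, add_cell k x.1 AB.2).

(** For [x] before [y]: an upper exceeds everything before it, and a lower
    exceeds the earlier lowers.  The predicate [u] singles out the uppers. *)
Definition shuffle_rel (u : pred entry) (x y : entry) : bool :=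
  [&& x.1 < y.1, x.2 != y.2 & (u x ==> u y) ==> (x.2 < y.2)].

(** Uppers that came in time for the lower [y] but have smaller values. *)
Lemma greedy_skip (Q us : seq entry) (y : entry) (ls : seq entry) :
  all (fun q => (q.1 <= y.1) && (q.2 < y.2)) Q ->
  greedy (Q ++ us) (y :: ls) = greedy us (y :: ls).
Proof.
elim: Q => //= q Q IH /andP[/andP[le_q lt_q] /IH def_us].
by rewrite greedy_cons ltnNge le_q /= lt_q.
Qed.

(** The state of the insertion before the entries [r].  The first row of the
    insertion tableau is [P ++ unzip2 Q]: the queue [Q] holds the uppers that
    exceed all lowers so far, and [P] lies below every later entry that is
    inserted.  An upper joins the end of [Q].  A lower [x] retires the uppers of
    [Q] with smaller values to [P] and bumps the next one if there is one; this
    is what [greedy] does on the heads of [Q] and of the lowers.  The bumped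
    values come in increasing order, so the second row grows at its end. *)
Lemma RS_greedy_rec (u : pred entry) (r Q : seq entry) (P R2 B1 B2 : seq nat) :
  pairwise (shuffle_rel u) r ->
  (forall x z, x \in r -> u x -> z \in P ++ unzip2 Q ++ R2 -> z < x.2) ->
  (forall x z, x \in r -> ~~ u x -> z \in P -> z < x.2) ->
  (forall x, x \in r -> x.2 \notin unzip2 Q) ->
  (forall x q, x \in r -> q \in Q -> q.1 < x.1) ->
  sorted ltn (unzip2 Q) ->
  (forall z q, z \in R2 -> q \in unzip2 Q -> z < q) ->
  size B1 = size (P ++ unzip2 Q) -> size B2 = size R2 -> (B1 = [::] -> R2 = [::]) ->
  let M := greedy (Q ++ filter u r) (filter (predC u) r) in
  exists P' B1',
    [/\ foldl RS_step (two_rows (P ++ unzip2 Q) R2, two_rows B1 B2) r =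
          (two_rows P' (R2 ++ bumped M), two_rows B1' (B2 ++ bumping M)),
        perm_eq (P' ++ bumped M) (P ++ unzip2 Q ++ unzip2 r) &
        perm_eq (B1' ++ bumping M) (B1 ++ unzip1 r)].
Proof.
elim: r Q P R2 B1 B2 => [|x r IH] Q P R2 B1 B2 /=.
  move=> *; exists (P ++ unzip2 Q), B1.
  by rewrite greedy_nil_r /= !cats0.
case/andP=> /allP ok_x ok_r up lo dis lt_Q Q_sorted lt_R2 szB1 szB2 nil12.
have nilA : P ++ unzip2 Q = [::] -> R2 = [::].
  by move=> e; apply: nil12; apply: size0nil; rewrite szB1 e.
have nilB : B1 = [::] -> B2 = [::].
  by move/nil12 => e; apply: size0nil; rewrite szB2 e.
have xr := mem_head x r.
have rr y : y \in r -> y \in x :: r by rewrite inE orbC => ->.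
rewrite {2}/RS_step.
case: (boolP (u x)) => [ux|nux] /=.
  rewrite insert_row1 ?add_cell1 //; last first.
    apply/allP=> z z_in; apply: ltnW; apply: up (xr) ux _.
    by rewrite catA mem_cat z_in.
  have [|||||||||| P' [B1' [eAB eA eB]]] := IH (rcons Q x) P R2 (rcons B1 x.1) B2 => //.
  - move=> y z yr uy; rewrite /unzip2 map_rcons -cats1 -catA !mem_cat.
    case/or4P=> zin; try by apply: up (rr _ yr) uy _; rewrite !mem_cat zin ?orbT.
    move: zin; rewrite inE => /eqP->.
    by have /and3P[_ _] := ok_x y yr; rewrite ux uy.
  - by move=> y z yr; apply: lo (rr _ yr).
  - move=> y yr; rewrite /unzip2 map_rcons mem_rcons inE negb_or dis ?rr // andbT.
    by have /and3P[_ ne _] := ok_x y yr; rewrite eq_sym.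
  - move=> y q yr; rewrite mem_rcons inE => /predU1P[->|].
      by have /and3P[] := ok_x y yr.
    exact: lt_Q (rr _ yr).
  - rewrite /unzip2 map_rcons -cats1 (sorted_pairwise ltn_trans) pairwise_cat.
    rewrite -(sorted_pairwise ltn_trans) Q_sorted /= andbT; apply/allrelP=> z y z_in.
    rewrite inE => /eqP->; apply: up (xr) ux _.
    by rewrite !mem_cat z_in orbT.
  - move=> z q zin; rewrite /unzip2 map_rcons mem_rcons inE => /predU1P[->|].
      by apply: up (xr) ux _; rewrite !mem_cat zin !orbT.
    exact: lt_R2.
  - by rewrite /unzip2 map_rcons -rcons_cat !size_rcons szB1.
  - by case: (B1).
  exists P', B1'; move: eAB eA eB.
  rewrite /unzip2 map_rcons -rcons_cat !cat_rcons -!/(unzip2 _) -!/(unzip1 _).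
  by move=> -> eA eB; split.
(* [Q1] retires to the left of [x], and the head of [Q2] is bumped *)
pose i := find (fun q => x.2 < q.2) Q.
have defQ : Q = take i Q ++ drop i Q by rewrite cat_take_drop.
set Q1 := take i Q in defQ; set Q2 := drop i Q in defQ.
have ltQ1 : all (fun q => q.2 < x.2) Q1.
  apply/(all_nthP x) => j; rewrite size_take_min ltn_min => /andP[lt_ji lt_jQ].
  have /= le_j := before_find x lt_ji.
  rewrite nth_take // ltn_neqAle leqNgt le_j andbT.
  apply: contraNneq (dis x xr) => <-; apply: map_f; exact: mem_nth.
have skip us ls : greedy (Q ++ us) (x :: ls) = greedy (Q2 ++ us) (x :: ls).
  rewrite defQ -catA greedy_skip //; apply/allP=> q qQ.
  by rewrite (allP ltQ1) // andbT ltnW // lt_Q // defQ mem_cat qQ.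
rewrite skip.
have le_PQ1 : all (leq^~ x.2) (P ++ unzip2 Q1).
  rewrite all_cat; apply/andP; split; first by apply/allP=> z zP; rewrite ltnW // lo.
  by rewrite all_map; apply: sub_all ltQ1 => q /= /ltnW.
have Q2P q Q2' : Q2 = q :: Q2' -> x.2 < q.2.
  move=> eQ2; have lt_i : i < size Q by rewrite -subn_gt0 -size_drop -/Q2 eQ2.
  have := nth_find q (etrans (has_find _ _) lt_i).
  by rewrite -/i -[i in nth _ _ i]addn0 -nth_drop -/Q2 eQ2.
case eQ2: Q2 => [|q Q2'].
  have eQ1 : Q = Q1 by rewrite defQ eQ2 cats0.
  have -> : greedy ([::] ++ filter u r) (x :: filter (predC u) r) =
            greedy ([::] ++ filter u r) (filter (predC u) r).
    case def_us: (filter u r) => [|y us]; first by rewrite /= !greedy_nil.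
    have yr : y \in r by have := mem_head y us; rewrite -def_us mem_filter => /andP[].
    by have /and3P[lt_xy _ _] := ok_x y yr; rewrite /= greedy_cons lt_xy.
  rewrite insert_row1 ?add_cell1 //; last by rewrite eQ1.
  have [|||||||||| P' [B1' [eAB eA eB]]] :=
    IH [::] (rcons (P ++ unzip2 Q) x.2) R2 (rcons B1 x.1) B2 => //.
  - move=> y z yr uy; rewrite mem_cat mem_rcons inE -orbA => /predU1P[->|zin].
      by have /and3P[_ _] := ok_x y yr; rewrite uy implybT.
    by apply: up (rr _ yr) uy _; rewrite catA mem_cat.
  - move=> y z yr uy; have /and3P[_ _] := ok_x y yr; rewrite (negPf nux) /= => lt_xy.
    rewrite mem_rcons inE => /predU1P[->|] //; rewrite eQ1 => zin.
    by apply: leq_ltn_trans lt_xy; apply: (allP le_PQ1).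
  - by rewrite cats0 !size_rcons szB1.
  - by case: (B1).
  exists P', B1'; move: eAB eA eB; rewrite cats0 !cat_rcons /=.
  by rewrite -catA => -> eA eB; split.
have lt_xq := Q2P _ _ eQ2.
have defQ' : Q = Q1 ++ q :: Q2' by rewrite -eQ2.
have qQ : q \in Q by rewrite defQ' mem_cat mem_head orbT.
have eq_M : greedy ((q :: Q2') ++ filter u r) (x :: filter (predC u) r) =
    (q, x) :: greedy (Q2' ++ filter u r) (filter (predC u) r).
  by rewrite /= greedy_cons ltnNge ltnW ?lt_Q //= ltnNge ltnW.
have eP : P ++ unzip2 Q = (P ++ unzip2 Q1) ++ q.2 :: unzip2 Q2'.
  by rewrite defQ' /unzip2 map_cat catA.
have Q2_sorted : sorted ltn (q.2 :: unzip2 Q2').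
  move: Q_sorted; rewrite defQ' /unzip2 map_cat; by case/cat_sorted2.
rewrite eq_M eP insert_row2 //; last first.
  by apply/allP=> z zR2; rewrite ltnW // lt_R2 //; apply: map_f.
have lt_R2q z : z \in R2 -> z < q.2.
  by move=> zR2; apply: lt_R2 zR2 _; apply: map_f.
have nzB : B1 <> [::] by move=> eB; move: szB1; rewrite eP eB size_cat addnS.
rewrite add_cell2 //.
have eP' : (P ++ unzip2 Q1) ++ x.2 :: unzip2 Q2' =
           rcons (P ++ unzip2 Q1) x.2 ++ unzip2 Q2' by rewrite cat_rcons.
have [|||||||||| P' [B1' [eAB eA eB]]] :=
  IH Q2' (rcons (P ++ unzip2 Q1) x.2) (rcons R2 q.2) B1 (rcons B2 x.1) => //.
- move=> y z yr uy; rewrite cat_rcons -!catA !(mem_cat, inE) mem_rcons inE.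
  have upy := up _ z (rr _ yr) uy.
  case/or4P=> [zin|zin|/eqP->|].
  - by apply: upy; rewrite mem_cat zin.
  - by apply: upy; rewrite defQ' /unzip2 map_cat !mem_cat zin !orbT.
  - by have /and3P[_ _] := ok_x y yr; rewrite uy implybT.
  case/or3P=> [zin|/eqP->|zin].
  - by apply: upy; rewrite defQ' /unzip2 map_cat !(mem_cat, inE) zin !orbT.
  - by apply: up (rr _ yr) uy _; rewrite defQ' /unzip2 map_cat !(mem_cat, inE) eqxx !orbT.
  by apply: upy; rewrite !mem_cat zin !orbT.
- move=> y z yr uy; have /and3P[_ _] := ok_x y yr; rewrite (negPf nux) /= => lt_xy.
  rewrite mem_rcons inE => /predU1P[->|zin] //.
  by apply: leq_ltn_trans lt_xy; apply: (allP le_PQ1).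
- move=> y yr; have := dis y (rr _ yr); rewrite defQ' /unzip2 map_cat mem_cat inE.
  by rewrite !negb_or => /and3P[].
- move=> y z yr zQ; apply: lt_Q (rr _ yr) _.
  by rewrite defQ' mem_cat inE zQ !orbT.
- exact: path_sorted Q2_sorted.
- move=> z t; rewrite mem_rcons inE => /predU1P[->|zR2] tQ.
    exact: (allP (order_path_min ltn_trans Q2_sorted)).
  by apply: lt_R2 zR2 _; rewrite defQ' /unzip2 map_cat mem_cat inE tQ !orbT.
- by rewrite -eP' szB1 eP !size_cat.
- by rewrite !size_rcons szB2.
exists P', B1'; move: eAB eA eB; rewrite -eP' !cat_rcons => -> eA eB; split=> //.
  rewrite catA eP; apply/seq.permP=> a; move/seq.permP: eA => /(_ a).
  by rewrite /= !count_cat /= !count_cat /=; clear; clear; lia.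
apply/seq.permP=> a; move/seq.permP: eB => /(_ a).
by rewrite /= !count_cat /=; clear; lia.
Qed.

(** * The path of a greedy matching *)

Definition entries (s : seq nat) : seq entry := zip (iota 1 (size s)) s.

Definition greedy_split (u : pred entry) (s : seq nat) : seq (entry * entry) :=
  greedy (filter u (entries s)) (filter (predC u) (entries s)).

Definition step_word (n : nat) (OB OC : seq nat) : seq bool :=
  [seq i \notin OB | i <- iota 1 n] ++ rev [seq i \in OC | i <- iota 1 n].

(** Complementation within 1, ..., n turns first rows into second rows, which
    are the matched values and positions. *)
Lemma RSK_steps_greedy (n : nat) (u : pred entry) (s : seq nat) :
  perm_eq s (iota 1 n) -> pairwise (shuffle_rel u) (entries s) ->
  RSK_steps s = step_word n (bumped (greedy_split u s)) (bumping (greedy_split u s)).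
Proof.
move=> perm_s ok_s; have sz : size s = n by rewrite (perm_size perm_s) size_iota.
have [||||||||| P [B1]] := @RS_greedy_rec u (entries s) [::] [::] [::] [::] [::] ok_s => //.
rewrite [[::] ++ _]/= -/(greedy_split u s); set M := greedy_split u s.
have -> : unzip1 (entries s) = iota 1 n by rewrite unzip1_zip ?size_iota ?sz.
have -> : unzip2 (entries s) = s by rewrite unzip2_zip ?size_iota.
rewrite [two_rows _ _]/= !cat0s => -[eAB eA eB].
have -> : RSK_steps s =
    [seq i \in P | i <- iota 1 n] ++ rev [seq i \notin B1 | i <- iota 1 n].
  rewrite /RSK_steps /RS -/(entries s) -/RS_step eAB !nth_two_rows sz.
  by congr (_ ++ rev _); apply: eq_map => i; case: ifP.
rewrite /step_word; have eA' := perm_trans eA perm_s.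
have uA : uniq (P ++ bumped M) by rewrite (perm_uniq eA') iota_uniq.
have uB : uniq (B1 ++ bumping M) by rewrite (perm_uniq eB) iota_uniq.
congr (_ ++ rev _); apply/eq_in_map => i i_in.
  have := perm_mem eA' i; rewrite i_in mem_cat => /orP; case: (boolP (i \in P)) => iP.
    move=> _; symmetry; apply: contraL uA => iM; rewrite cat_uniq.
    by rewrite negb_and negb_and; apply/orP; right; apply/orP; left; rewrite negbK; apply/hasP; exists i.
  by case=> // ->.
have := perm_mem eB i; rewrite i_in mem_cat => /orP; case: (boolP (i \in B1)) => iP.
  move=> _; symmetry; apply: contraTF uB => iM; rewrite cat_uniq.
  by rewrite negb_and negb_and; apply/orP; right; apply/orP; left; rewrite negbK; apply/hasP; exists i.
by case=> // ->.
Qed.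

Lemma subseq_greedy1 us ls : subseq [seq m.1 | m <- greedy us ls] us.
Proof.
elim: us ls => [|x us IHu] ls; first by rewrite greedy_nil.
elim: ls => [|y ls IHl]; first exact: sub0seq.
rewrite greedy_cons; case: ifP => // _; case: ifP => _.
  exact: subseq_trans (IHu _) (subseq_cons _ _).
by rewrite /= eqxx.
Qed.

Lemma subseq_greedy2 us ls : subseq [seq m.2 | m <- greedy us ls] ls.
Proof.
elim: us ls => [|x us IHu] ls; first by rewrite greedy_nil sub0seq.
elim: ls => [|y ls IHl]; first by [].
rewrite greedy_cons; case: ifP => _; first exact: subseq_trans IHl (subseq_cons _ _).
case: ifP => _; first exact: IHu.
by rewrite /= eqxx.
Qed.

Lemma greedy_edge us ls m :
  m \in greedy us ls -> (m.1.1 <= m.2.1) /\ (m.2.2 <= m.1.2).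
Proof.
elim: us ls => [|x us IHu] ls; first by rewrite greedy_nil.
elim: ls => [|y ls IHl] //.
rewrite greedy_cons; case: ltnP => // le1; case: ltnP => [_ /IHu|le2] //.
by rewrite inE => /predU1P[->|/IHu].
Qed.

Lemma greedy_map (f g : nat -> nat) us ls :
  {mono f : x y / x < y} -> {mono g : x y / x < y} ->
  let h (x : entry) := (f x.1, g x.2) in
  greedy (map h us) (map h ls) = [seq (h m.1, h m.2) | m <- greedy us ls].
Proof.
move=> fm gm h; elim: us ls => [|x us IHu] ls; first by rewrite !greedy_nil.
elim: ls => [|y ls IHl] //.
rewrite !map_cons !greedy_cons /= fm gm -map_cons IHl.
by rewrite -map_cons (IHu (y :: ls)) IHu; case: ifP => //; case: ifP.
Qed.

(** Each first component is dominated by its partner, which is not a first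
    component; hence first components are in a minority in every initial
    segment. *)
Lemma count_iota_le (M : seq (nat * nat)) (k : nat) :
  uniq (unzip2 M) -> (forall x, x \in unzip2 M -> x \notin unzip1 M) ->
  (forall m, m \in M -> 0 < m.2 <= m.1) ->
  count [in unzip1 M] (iota 1 k) <= count [predC unzip1 M] (iota 1 k).
Proof.
move=> u2 dis ok; apply: (@leq_trans (count (fun m => m.1 <= k) M)).
  rewrite -!size_filter -(size_map fst [seq _ <- M | _]).
  apply: uniq_leq_size; first by rewrite filter_uniq ?iota_uniq.
  move=> x; rewrite mem_filter mem_iota => /andP[/mapP[m mM ->] /andP[_ lt_m]].
  by apply: map_f; rewrite mem_filter mM andbT; lia.
apply: (@leq_trans (count (fun m => m.2 <= k) M)).
  rewrite (@eq_in_count _ _ (fun m => (m.1 <= k) && (m.2 <= k))).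
    by apply: sub_count => m /andP[].
  by move=> m /ok /=; lia.
rewrite -!size_filter -(size_map snd [seq _ <- M | _]).
apply: uniq_leq_size.
  by apply: subseq_uniq u2; apply: map_subseq; apply: filter_subseq.
move=> x /mapP[m m_in ->]; have /andP[/= le_m mM] : (m.2 <= k) && (m \in M) by move: m_in; rewrite mem_filter.
rewrite mem_filter mem_iota /= dis ?map_f //=.
by rewrite add1n ltnS le_m andbT; have /andP[] := ok m mM.
Qed.

Lemma count_mem_iota (n : nat) (X : seq nat) :
  uniq X -> (forall x, x \in X -> 0 < x <= n) ->
  count [in X] (iota 1 n) = size X.
Proof.
move=> uX ok; rewrite -size_filter; apply: perm_size; apply: uniq_perm => //.
  by rewrite filter_uniq ?iota_uniq.
move=> x; rewrite mem_filter mem_iota andb_idr // => /ok; lia.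
Qed.

Lemma count_notin (X s : seq nat) :
  (count_mem true [seq i \notin X | i <- s] = count [predC X] s) *
  (count_mem false [seq i \notin X | i <- s] = count [in X] s).
Proof. by rewrite !count_map; split; apply: eq_count => i /=; case: (_ \in _). Qed.

Lemma count_in (X s : seq nat) :
  (count_mem true [seq i \in X | i <- s] = count [in X] s) *
  (count_mem false [seq i \in X | i <- s] = count [predC X] s).
Proof. by rewrite !count_map; split; apply: eq_count => i /=; case: (_ \in _). Qed.

(** The prefixes of length at most n are controlled by the matched values b and
    their partners d <= b; the suffixes of length at most n by the matched
    positions c and their partners a <= c. *)
Lemma step_word_dyck (n : nat) (M : seq (entry * entry)) :
  let vals := bumped M ++ [seq m.2.2 | m <- M] in
  let poss := bumping M ++ [seq m.1.1 | m <- M] in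
  uniq vals -> uniq poss ->
  (forall x, x \in vals ++ poss -> 0 < x <= n) ->
  (forall m, m \in M -> (m.1.1 <= m.2.1) /\ (m.2.2 <= m.1.2)) ->
  is_dyck n (step_word n (bumped M) (bumping M)).
Proof.
move=> vals poss uv up ok edge.
move: (uv) (up); rewrite !cat_uniq.
case/and3P=> uv1 dv uv2 /and3P[up1 dp up2].
have okB x : x \in bumped M -> 0 < x <= n.
  by move=> xM; apply: ok; rewrite !mem_cat xM.
have okC x : x \in bumping M -> 0 < x <= n.
  by move=> xM; apply: ok; rewrite !mem_cat xM ?orbT.
have cB := count_mem_iota uv1 okB; have cC := count_mem_iota up1 okC.
have cB' := count_predC [in bumped M] (iota 1 n).
have cC' := count_predC [in bumping M] (iota 1 n).
have szM : size (bumped M) = size (bumping M) by rewrite !size_map.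
rewrite size_iota in cB' cC'.
have balB k : count [in bumped M] (iota 1 k) <= count [predC bumped M] (iota 1 k).
  have := @count_iota_le [seq (m.1.2, m.2.2) | m <- M] k.
  rewrite /unzip1 /unzip2 -!map_comp; apply => //.
    by move=> x xM; apply: contra dv => xB; apply/hasP; exists x.
  move=> m' /mapP[m mM ->] /=; have [_ ->] := edge m mM; rewrite andbT.
  suff : 0 < m.2.2 <= n by case/andP.
  apply: ok; rewrite !mem_cat; apply/orP; left; apply/orP; right.
  by apply/mapP; exists m.
have balC k : count [in bumping M] (iota 1 k) <= count [predC bumping M] (iota 1 k).
  have := @count_iota_le [seq (m.2.1, m.1.1) | m <- M] k.
  rewrite /unzip1 /unzip2 -!map_comp; apply => //.
    by move=> x xM; apply: contra dp => xB; apply/hasP; exists x.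
  move=> m' /mapP[m mM ->] /=; have [-> _] := edge m mM; rewrite andbT.
  suff : 0 < m.1.1 <= n by case/andP.
  apply: ok; rewrite !mem_cat; apply/orP; right; apply/orP; right.
  by apply/mapP; exists m.
have tot b : count_mem b (step_word n (bumped M) (bumping M)) = n.
  by rewrite count_cat count_rev; case: b; rewrite count_notin count_in; lia.
apply/is_dyckP; split=> // k.
have [le_k|lt_k] := leqP k n.
  rewrite takel_cat ?size_map ?size_iota // -map_take take_iota (minn_idPl le_k).
  by rewrite !count_notin.
have tot' b : count_mem b (take k (step_word n (bumped M) (bumping M))) +
    count_mem b (drop k (step_word n (bumped M) (bumping M))) = n.
  by rewrite -count_cat cat_take_drop tot.
have : count_mem true (drop k (step_word n (bumped M) (bumping M))) <=
       count_mem false (drop k (step_word n (bumped M) (bumping M))).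
  rewrite drop_cat size_map size_iota ltnNge (ltnW lt_k) /= drop_rev !count_rev.
  by rewrite -map_take take_iota !count_in; apply: balC.
by have := tot' true; have := tot' false; lia.
Qed.

(** * One changed step and promotion *)

(** The word of a matching whose values are lowered by 1 and whose positions are
    raised by 1, as in the comparison of the two greedy matchings. *)
Definition shifted_word (n : nat) (OB' OC' : seq nat) : seq bool :=
  [seq i \notin OB' | i <- iota 0 n] ++ rev [seq i \in OC' | i <- iota 2 n].

(** When both are Dyck words, this says that promotion maps [w'] to [w]. *)
Definition promotion_form (w w' : seq bool) : Prop :=
  exists al ga, [/\ w' = stepU :: al ++ stepR :: ga,
    w = al ++ stepU :: ga ++ [:: stepR] & count_mem stepU al = count_mem stepR al].

Lemma iota_rcons (m n : nat) : iota m n.+1 = rcons (iota m n) (m + n).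
Proof. by rewrite -addn1 iotaD cats1. Qed.

Lemma iota_split (m b n : nat) :
  m <= b < m + n -> iota m n = iota m (b - m) ++ b :: iota b.+1 (m + n - b.+1).
Proof.
move=> /andP[le_mb lt_bn]; have -> : n = (b - m) + (m + n - b.+1).+1 by lia.
by rewrite iotaD /= subnKC //; congr (_ ++ _ :: iota _ _); lia.
Qed.

Lemma eq_in_seq (X Y : seq nat) (s : seq nat) :
  {in s, X =i Y} -> [seq i \in X | i <- s] = [seq i \in Y | i <- s].
Proof. by move=> e; apply/eq_in_map. Qed.

Lemma eq_notin_seq (X Y : seq nat) (s : seq nat) :
  {in s, X =i Y} -> [seq i \notin X | i <- s] = [seq i \notin Y | i <- s].
Proof. by move=> e; apply/eq_in_map=> i /e ->. Qed.

(** The changed step is that of the value [b]; for [b = n] it is the middle step,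
    which stands for the value [n] in one word and for the position [n.+1] in the
    other. *)
Lemma value_flip_form (n b : nat) (OB OC OB' OC' : seq nat) :
  0 < b <= n -> 0 \notin OB' -> 1 \notin OC -> b \notin OB ->
  (forall i, i < n -> i != b -> (i \in OB') = (i \in OB)) ->
  (forall i, i <= n -> (i \in OC') = (i \in OC)) ->
  (b < n -> b \in OB' /\ (n.+1 \in OC') = (n \notin OB)) ->
  (b = n -> n.+1 \notin OC') ->
  count [in OB] (iota 1 b.-1) = count [predC OB] (iota 1 b.-1) ->
  promotion_form (step_word n OB OC) (shifted_word n OB' OC').
Proof.
case: n => [|n]; first by case: b.
move=> /andP[b_gt0 le_bn] nB0 nC1 nBb eqB eqC flip_lt flip_n bal.
exists [seq i \notin OB | i <- iota 1 b.-1].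
exists ([seq i \notin OB | i <- iota b.+1 (n.+1 - b)] ++ rev [seq i \in OC | i <- iota 2 n]).
have defC : rev [seq i \in OC' | i <- iota 2 n.+1] =
    (n.+2 \in OC') :: rev [seq i \in OC | i <- iota 2 n].
  rewrite iota_rcons map_rcons rev_rcons; congr (_ :: rev _).
  by apply: eq_in_seq => i; rewrite mem_iota => ?; apply: eqC; lia.
have defB1 : [seq i \notin OB' | i <- iota 1 b.-1] = [seq i \notin OB | i <- iota 1 b.-1].
  by apply: eq_notin_seq => i; rewrite mem_iota => ?; apply: eqB; lia.
split; last by rewrite !count_notin bal.
  rewrite /shifted_word defC /= nB0 /=; congr (_ :: _).
  case: (ltngtP b n.+1) le_bn => // [lt_bn|eq_bn] _.
    have [Bb eqn] := flip_lt lt_bn.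
    rewrite (@iota_split 1 b n) ?map_cat; last by lia.
    rewrite subn1 defB1 /= Bb -catA /= eqn; congr (_ ++ _ :: _).
    have -> : n.+1 - b = (1 + n - b.+1).+1 by lia.
    rewrite iota_rcons map_rcons cat_rcons.
    have -> : b.+1 + (1 + n - b.+1) = n.+1 by lia.
    congr (_ ++ _).
    by apply: eq_notin_seq => i; rewrite mem_iota => ?; apply: eqB; lia.
  by rewrite -[n]/(n.+1.-1) -{1}eq_bn defB1 eq_bn subnn (negPf (flip_n eq_bn)).
rewrite /step_word {1}(@iota_split 1 b n.+1) ?map_cat; last by lia.
by rewrite subn1 /= nBb (negPf nC1) rev_cons -cats1 -!catA.
Qed.

(** The changed step is that of the position [c].  Here the part of the word
    after this step is known to be balanced up to the last R, and the balance of
    the part before it follows since the whole word is balanced. *)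
Lemma position_flip_form (n c : nat) (OB OC OB' OC' : seq nat) :
  1 < c <= n -> 0 \notin OB' -> 1 \notin OC -> c \in OC -> c \notin OC' ->
  (forall i, i < n -> (i \in OB') = (i \in OB)) ->
  (forall i, i <= n -> i != c -> (i \in OC') = (i \in OC)) ->
  (n.+1 \in OC') = (n \notin OB) ->
  (count [in OC] (iota 1 c.-1)).+1 = count [predC OC] (iota 1 c.-1) ->
  is_dyck n (step_word n OB OC) ->
  promotion_form (step_word n OB OC) (shifted_word n OB' OC').
Proof.
case: n => [|n]; first by case: c => [|[]].
move=> /andP[c_gt1 le_cn] nB0 nC1 Cc nCc eqB eqC eqn bal dy.
have [def1 def2] : iota 1 n.+1 = 1 :: iota 2 (c - 2) ++ c :: iota c.+1 (n.+1 - c) /\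
    iota 2 n.+1 = iota 2 (c - 2) ++ c :: iota c.+1 (n.+1 - c) ++ [:: n.+2].
  rewrite (iota_rcons 2) [iota 1 _]/= (@iota_split 2 c n) ?rcons_cat; last by lia.
  have -> : 2 + n - c.+1 = n.+1 - c by lia.
  by rewrite -cats1.
pose al := [seq i \notin OB | i <- iota 1 n.+1] ++
  rev [seq i \in OC | i <- iota c.+1 (n.+1 - c)].
pose ga := rev [seq i \in OC | i <- iota 2 (c - 2)].
have defW : step_word n.+1 OB OC = al ++ stepU :: ga ++ [:: stepR].
  have -> : step_word n.+1 OB OC = [seq i \notin OB | i <- iota 1 n.+1] ++
      rev (false :: [seq i \in OC | i <- iota 2 (c - 2)] ++
           true :: [seq i \in OC | i <- iota c.+1 (n.+1 - c)]).
    by rewrite /step_word; congr (_ ++ rev _); rewrite def1 /= map_cat /= Cc (negPf nC1).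
  by rewrite rev_cons rev_cat rev_cons -!cats1 -!catA.
have def_al : al = [seq i \notin OB | i <- iota 1 n] ++ (n.+1 \notin OB) ::
    rev [seq i \in OC | i <- iota c.+1 (n.+1 - c)].
  by rewrite /al iota_rcons map_rcons cat_rcons.
clearbody al; exists al, ga; split=> //.
  rewrite /shifted_word def2 /= nB0 /= map_cat rev_cat /= (negPf nCc) map_cat rev_cons rev_cat /=.
  rewrite eqn cat_rcons def_al /ga -catA /=.
  congr (_ :: _ ++ _ :: rev _ ++ _ :: rev _).
  - by apply: eq_notin_seq => i; rewrite mem_iota => ?; apply: eqB; lia.
  - by apply: eq_in_seq => i; rewrite mem_iota => ?; apply: eqC; lia.
  - by apply: eq_in_seq => i; rewrite mem_iota => ?; apply: eqC; lia.
have [dU dR _] := (is_dyckP _ _).1 dy.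
have balg : count_mem stepU ga = count_mem stepR ga.
  rewrite /ga !count_rev !count_in; move: bal.
  have -> : c.-1 = (c - 2).+1 by lia.
  by rewrite /= (negPf nC1); lia.
clearbody ga; move: dU dR; rewrite defW !count_cat /= !count_cat /= balg.
by move: (count_mem _ al) (count_mem _ al) (count_mem _ ga) => x y z; lia.
Qed.

Lemma sorted_ltn_split (p r : seq nat) (x : nat) :
  sorted ltn (p ++ x :: r) -> all (gtn x) p /\ all (ltn x) r.
Proof.
rewrite (sorted_pairwise ltn_trans) pairwise_cat /= allrel_consr -andbA.
by case/and5P=> px _ _ xr _; split.
Qed.

(** Two complementary increasing sequences are [p ++ ps] and [q ++ qs].  Both are
    cut at the threshold [x], so [p] and [q] share out the numbers below [x]. *)
Lemma count_below (m x : nat) (p q ps qs X : seq nat) :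
  perm_eq ((p ++ ps) ++ (q ++ qs)) (iota 1 m) -> x <= m.+1 -> 0 < x ->
  all (gtn x) p -> all (leq x) ps -> all (gtn x) q -> all (leq x) qs ->
  (forall i, i < x -> (i \in X) = (i \in p)) ->
  count [in X] (iota 1 x.-1) = size p /\ count [predC X] (iota 1 x.-1) = size q.
Proof.
move=> perm_m le_x x_gt0 lt_p ge_ps lt_q ge_qs eqX.
have u : uniq ((p ++ ps) ++ (q ++ qs)) by rewrite (perm_uniq perm_m) iota_uniq.
have perm_pq : perm_eq (iota 1 x.-1) (p ++ q).
  apply: uniq_perm; first exact: iota_uniq.
    apply: subseq_uniq u; apply: cat_subseq; exact: prefix_subseq.
  move=> i; rewrite mem_cat mem_iota add1n prednK //.
  have := perm_mem perm_m i; rewrite mem_iota !mem_cat => mem_i.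
  apply/idP/idP => [/andP[i_gt0 lt_i]|].
    move: mem_i; rewrite i_gt0 (leq_trans lt_i) //=.
    case/orP=> /orP[->|] //; rewrite ?orbT //.
      by move/(allP ge_ps); rewrite /= leqNgt lt_i.
    by move/(allP ge_qs); rewrite /= leqNgt lt_i.
  case/orP=> i_in; move: mem_i; rewrite i_in ?orbT /= => /esym/andP[-> _] /=.
    exact: (allP lt_p).
  exact: (allP lt_q).
have q_p i : i \in q -> i \notin p.
  move=> iq; move: u; rewrite cat_uniq => /and3P[_ dis _].
  apply: contra dis => ip; apply/hasP; exists i; first by rewrite mem_cat iq.
  by rewrite mem_cat ip.
have Xp i : i \in p -> i \in X by move=> ip; rewrite eqX //; apply: (allP lt_p).
have Xq i : i \in q -> i \notin X.
  by move=> iq; rewrite eqX ?q_p //; apply: (allP lt_q).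
move/seq.permP: perm_pq => eqc; rewrite !eqc !count_cat; split.
  rewrite (_ : count _ p = size p); last by apply/eqP; rewrite -all_count; apply/allP.
  rewrite (_ : count _ q = 0) ?addn0 //; apply/eqP; rewrite -leqn0 leqNgt -has_count.
  by apply/hasPn.
rewrite (_ : count _ q = size q); last by apply/eqP; rewrite -all_count; apply/allP.
rewrite (_ : count _ p = 0) //; apply/eqP; rewrite -leqn0 leqNgt -has_count.
by apply/hasPn=> i /Xp /=; rewrite negbK.
Qed.

Lemma mem_opt_seq (e : bool) (x i : nat) : (i \in opt_seq e x) = e && (i == x).
Proof. by case: e; rewrite //= inE. Qed.

Lemma perm_iota_range (s : seq nat) (n x : nat) :
  perm_eq s (iota 1 n) -> x \in s -> 0 < x <= n.
Proof. by move=> perm_s; rewrite (perm_mem perm_s) mem_iota add1n ltnS. Qed.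

(** The balance of alpha comes from [size pd = size pb], or from
    [size pa = size pc], as below the changed element the matched and the
    unmatched elements are exactly those of the two recorded prefixes. *)
Lemma one_flip_form (n : nat) (as_ bs cs ds OB OC OB' OC' : seq nat) :
  0 < n -> one_flip n n.+1 as_ bs cs ds OB OC OB' OC' ->
  sorted ltn bs -> last 0 bs = n -> sorted ltn cs -> last 0 cs = n.+1 ->
  sorted ltn ds -> sorted ltn (1 :: as_) ->
  perm_eq (bs ++ ds) (iota 1 n) -> perm_eq (cs ++ 1 :: as_) (iota 1 n.+1) ->
  subseq OB' bs -> n \notin OB' -> subseq OC cs -> n.+1 \notin OC ->
  is_dyck n (step_word n OB OC) ->
  promotion_form (step_word n OB OC) (shifted_word n OB' OC').
Proof.
move=> n_gt0 flip bs_s bs_l cs_s cs_l ds_s as_s permB permC subB nB' subC NC dy.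
have range_b b : b \in bs -> 0 < b <= n.
  by move=> bb; apply: (perm_iota_range permB); rewrite mem_cat bb.
have range_d b : b \in ds -> 0 < b <= n.
  by move=> bb; apply: (perm_iota_range permB); rewrite mem_cat bb orbT.
have range_c c : c \in cs -> 1 < c <= n.+1.
  move=> cc; have /andP[c_gt0 ->] : 0 < c <= n.+1.
    by apply: (perm_iota_range permC); rewrite mem_cat cc.
  rewrite andbT ltn_neqAle c_gt0 andbT eq_sym.
  have : uniq (cs ++ 1 :: as_) by rewrite (perm_uniq permC) iota_uniq.
  rewrite cat_uniq => /and3P[_ dis _]; apply: contraNneq dis => <-.
  by apply/hasP; exists c; rewrite ?mem_head.
have B0 : 0 \notin OB' by apply/negP=> /(mem_subseq subB)/range_b.
have C1 : 1 \notin OC by apply/negP=> /(mem_subseq subC)/range_c.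
have sB' : sorted ltn OB' by apply: (subseq_sorted ltn_trans) subB bs_s.
have sC : sorted ltn OC by apply: (subseq_sorted ltn_trans) subC cs_s.
have uBD : uniq (bs ++ ds) by rewrite (perm_uniq permB) iota_uniq.
have uCA : uniq (cs ++ 1 :: as_) by rewrite (perm_uniq permC) iota_uniq.
case: flip.
- move=> pb b rb pd rd X e def_bs rb_nz def_ds szp le_pd lt_rd def_B def_B' def_C'.
  have [lt_pb lt_rb] : all (gtn b) pb /\ all (ltn b) rb.
    by apply: sorted_ltn_split; rewrite -def_bs.
  have [_ lt_X] : all (gtn b) pb /\ all (ltn b) X.
    by apply: sorted_ltn_split; rewrite -def_B'.
  have b_bs : b \in bs by rewrite def_bs mem_cat mem_head orbT.
  have lt_bn : b < n.
    apply: (allP lt_rb); rewrite -bs_l def_bs last_cat /=.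
    by case: (rb) rb_nz => // x r _; rewrite /= mem_last.
  have lt_pd : all (gtn b) pd.
    apply/allP=> d d_pd; rewrite /= ltn_neqAle (allP le_pd) // andbT.
    move: uBD; rewrite cat_uniq => /and3P[_ dis _]; apply: contraNneq dis => eq_d.
    by apply/hasP; exists d; rewrite ?eq_d // def_ds mem_cat -eq_d d_pd.
  have nb_pb : b \notin pb by apply/negP=> /(allP lt_pb); rewrite /= ltnn.
  have nb_X : b \notin X by apply/negP=> /(allP lt_X); rewrite /= ltnn.
  have [npb nX] : n \notin pb /\ n \notin X.
    by move: nB'; rewrite def_B' mem_cat inE !negb_or => /and3P[].
  apply: (@value_flip_form _ b) => //.
  + by case/andP: (range_b b b_bs) => ->; rewrite ltnW.
  + by rewrite def_B !mem_cat mem_opt_seq (negPf nb_pb) (negPf nb_X) (ltn_eqF lt_bn) andbF.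
  + move=> i lt_in ne_ib; rewrite def_B def_B' !mem_cat mem_opt_seq inE (negPf ne_ib).
    by rewrite (ltn_eqF lt_in) andbF orbF.
  + move=> i le_in; rewrite def_C' mem_cat mem_opt_seq.
    by rewrite (ltn_eqF (_ : i < n.+1)) // andbF orbF.
  + move=> _; split; first by rewrite def_B' mem_cat mem_head orbT.
    rewrite def_C' def_B !mem_cat !mem_opt_seq (negPf NC) (negPf npb) (negPf nX).
    by rewrite !eqxx !andbT.
  + by move=> eq_bn; rewrite eq_bn ltnn in lt_bn.
  have [||||||||-> ->] // := @count_below n b pb pd (b :: rb) rd OB.
  + by rewrite -def_bs -def_ds.
  + by rewrite ltnW // ltnW.
  + by case/andP: (range_b b b_bs).
  + by rewrite /= leqnn; apply: sub_all lt_rb => i /ltnW.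
  + by apply: sub_all lt_rd => i /ltnW.
  move=> i lt_ib; rewrite def_B !mem_cat mem_opt_seq (ltn_eqF (ltn_trans lt_ib lt_bn)).
  rewrite andbF orbF; case: (boolP (i \in X)) => [/(allP lt_X)|]; last by rewrite orbF.
  by rewrite /= ltnNge ltnW.
- move=> pc c rc pa ra Y e def_cs rc_nz def_as szp le_pa lt_ra def_C def_C' def_B.
  have [lt_pc lt_rc] : all (gtn c) pc /\ all (ltn c) rc.
    by apply: sorted_ltn_split; rewrite -def_cs.
  have [_ lt_Y] : all (gtn c) pc /\ all (ltn c) Y.
    by apply: sorted_ltn_split; rewrite -def_C.
  have c_cs : c \in cs by rewrite def_cs mem_cat mem_head orbT.
  have lt_cN : c < n.+1.
    apply: (allP lt_rc); rewrite -cs_l def_cs last_cat /=.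
    by case: (rc) rc_nz => // x r _; rewrite /= mem_last.
  have lt_pa : all (gtn c) pa.
    apply/allP=> a a_pa; rewrite /= ltn_neqAle (allP le_pa) // andbT.
    move: uCA; rewrite cat_uniq => /and3P[_ dis _]; apply: contraNneq dis => eq_a.
    by apply/hasP; exists a; rewrite ?eq_a // def_as inE mem_cat -eq_a a_pa orbT.
  have nc_pc : c \notin pc by apply/negP=> /(allP lt_pc); rewrite /= ltnn.
  have nc_Y : c \notin Y by apply/negP=> /(allP lt_Y); rewrite /= ltnn.
  have [Npc NY] : n.+1 \notin pc /\ n.+1 \notin Y.
    by move: NC; rewrite def_C mem_cat inE !negb_or => /and3P[].
  have c_gt1 : 1 < c by case/andP: (range_c c c_cs).
  apply: (@position_flip_form _ c) => //.
  + by rewrite c_gt1.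
  + by rewrite def_C mem_cat mem_head orbT.
  + rewrite def_C' !mem_cat mem_opt_seq (negPf nc_pc) (negPf nc_Y) (ltn_eqF lt_cN).
    by rewrite andbF.
  + move=> i lt_in; rewrite def_B mem_cat mem_opt_seq (ltn_eqF lt_in).
    by rewrite andbF orbF.
  + move=> i le_in ne_ic; rewrite def_C def_C' !mem_cat mem_opt_seq inE (negPf ne_ic).
    by rewrite (ltn_eqF (_ : i < n.+1)) // andbF orbF.
  + rewrite def_C' def_B !mem_cat !mem_opt_seq (negPf Npc) (negPf NY) (negPf nB').
    by rewrite !eqxx !andbT.
  have [||||||||-> ->] // := @count_below n.+1 c pc (1 :: pa) (c :: rc) ra OC.
  + by rewrite -def_cs cat_cons -def_as.
  + by rewrite (leq_trans (ltnW lt_cN)) // leqnSn.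
  + by rewrite ltnW.
  + by rewrite /= leqnn; apply: sub_all lt_rc => i /ltnW.
  + by rewrite /= c_gt1.
  + by apply: sub_all lt_ra => i /ltnW.
  + move=> i lt_ic; rewrite def_C !mem_cat inE (ltn_eqF lt_ic) /=.
    case: (boolP (i \in Y)) => [/(allP lt_Y)|]; last by rewrite orbF.
    by rewrite /= ltnNge ltnW.
  by rewrite /= szp.
move=> def_bs def_cs szb szc eqB eqC.
rewrite eqB eqC; rewrite eqB in nB' B0 sB'.
have lt_B : all (gtn n) OB.
  have [] // : all (gtn n) OB /\ all (ltn n) [::].
  by apply: sorted_ltn_split; rewrite cats1 -def_bs.
have lt_D : all (gtn n) ds.
  apply/allP=> d d_ds; rewrite /= ltn_neqAle; case/andP: (range_d d d_ds) => _ ->.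
  rewrite andbT; move: uBD; rewrite cat_uniq => /and3P[_ dis _].
  apply: contraNneq dis => eq_d; apply/hasP; exists d => //.
  by rewrite def_bs mem_rcons eq_d mem_head.
apply: (@value_flip_form _ n) => //.
- by rewrite n_gt0 leqnn.
- by rewrite ltnn.
have [||||||||-> ->] // := @count_below n n OB ds [:: n] [::] OB.
- by rewrite cats0 cats1 -def_bs.
- by rewrite /= leqnn.
by move: szb; rewrite {1}def_bs size_rcons => -[].
Qed.

(** * Heights of a Dyck path over the unit strips *)

(** The heights of the successive R steps when the path starts at height [h]. *)
Fixpoint heights (h : nat) (s : seq bool) : seq nat :=
  match s with
  | [::] => [::]
  | true :: s' => heights h.+1 s'
  | false :: s' => h :: heights h s'
  end.

Lemma size_heights h s : size (heights h s) = count_mem stepR s.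
Proof. by elim: s h => [|[] s IH] h //=; rewrite IH. Qed.

Lemma path_heights h s : path leq h (heights h s).
Proof.
elim: s h => [|[] s IH] h //=; last by rewrite leqnn IH.
by case: (heights h.+1 s) (IH h.+1) => //= x t /andP[/ltnW-> ->].
Qed.

Lemma heights_le h s : all (leq^~ (h + count_mem stepU s)) (heights h s).
Proof.
elim: s h => [|[] s IH] h //=; first by rewrite addnA addn1; apply: IH.
by rewrite leq_addr IH.
Qed.

Lemma heights_gt c h s x :
  (forall k, c + count_mem stepR (take k s) <= h + count_mem stepU (take k s)) ->
  x < size (heights h s) -> c + x < nth 0 (heights h s) x.
Proof.
elim: s c h x => [|[] s IH] c h x //= bal lt_x.
  by apply: IH => // k; have := bal k.+1; rewrite /=; lia.
case: x lt_x => [|x] lt_x /=.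
  by have := bal 1; rewrite /= take0 /=; lia.
by rewrite addnS -addSn; apply: IH => // k; have := bal k.+1; rewrite /=; lia.
Qed.

(** A path is at its highest within abscissas at most [x] when it crosses the
    strip from [x] to [x.+1]. *)
Lemma heights_leP h s x y : x < size (heights h s) ->
  (nth 0 (heights h s) x <= y) <->
  (forall k, k <= size s -> count_mem stepR (take k s) <= x ->
             h + count_mem stepU (take k s) <= y).
Proof.
elim: s h x => [|[] s IH] h x //= lt_x.
  rewrite IH //; split=> le_y k lt_k le_x.
    case: k lt_k le_x => [|k] //= lt_k le_x; last by have := le_y k lt_k le_x; rewrite addSnnS.
    have := le_y 0 (leq0n _); rewrite take0 /=; lia.
  by have := le_y k.+1 lt_k; rewrite /= => /(_ le_x); lia.
case: x lt_x => [|x] lt_x /=.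
  split=> [le_y|le_y]; last by have := le_y 0; rewrite /= addn0; apply.
  by case=> [|k] //=; rewrite addn0.
rewrite IH //; split=> le_y k lt_k le_x.
  case: k lt_k le_x => [|k] //= lt_k le_x; last exact: le_y lt_k le_x.
  have := le_y 0 (leq0n _); rewrite take0 /=; lia.
exact: (le_y k.+1 lt_k le_x).
Qed.

Fixpoint of_heights (h : nat) (l : seq nat) : seq bool :=
  if l is y :: l' then nseq (y - h) true ++ false :: of_heights y l' else [::].

Lemma heights_nseq h m s : heights h (nseq m true ++ s) = heights (h + m) s.
Proof. by elim: m h => [|m IH] h /=; rewrite ?addn0 // IH addnS. Qed.

Lemma of_heightsK h l : path leq h l -> heights h (of_heights h l) = l.
Proof.
by elim: l h => //= y l IH h /andP[le_hy /IH]; rewrite heights_nseq subnKC //= => ->.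
Qed.

Lemma count_of_heights h l : path leq h l ->
  count_mem stepU (of_heights h l) = last h l - h /\
  count_mem stepR (of_heights h l) = size l.
Proof.
elim: l h => [|y l IH] h /=; first by rewrite subnn.
case/andP=> le_hy path_l; have [IHU IHR] := IH y path_l.
have le_yl : y <= last y l.
  by case: (l) path_l => // z t path_l; apply: (allP (order_path_min leq_trans path_l)); exact: (mem_last z t).
by rewrite !count_cat /= IHU IHR !count_nseq /=; lia.
Qed.

Lemma ballot_of_heights c h l k : path leq h l -> c <= h ->
  (forall x, x < size l -> c + x < nth 0 l x) ->
  c + count_mem stepR (take k (of_heights h l)) <=
  h + count_mem stepU (take k (of_heights h l)).
Proof.
elim: l c h k => [|y l IH] c h k /=; first by move=> _ le_ch _; rewrite /= !addn0.
case/andP=> le_hy path_l le_ch gt_l; rewrite take_cat size_nseq.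
case: ltnP => [lt_k|le_k].
  rewrite (take_nseq _ (ltnW lt_k)) !count_nseq mul0n addn0.
  exact: leq_trans le_ch (leq_addr _ _).
case def_k: (k - (y - h)) => [|k'] /=; first by rewrite ?cats0 !count_nseq mul0n addn0 (leq_trans le_ch) ?leq_addr.
have lt_cy : c < y by have := gt_l 0 isT; rewrite addn0.
have := IH c.+1 y k' path_l lt_cy; rewrite !count_cat !count_nseq /=.
suff gt_l' x : x < size l -> c.+1 + x < nth 0 l x by move=> /(_ gt_l'); lia.
by move=> lt_x; have := gt_l x.+1 lt_x; rewrite /=; lia.
Qed.

(** To make the induction on the word possible, [g] is the height of the R step
    before the word ([0] if there is none), so that [g < h] holds when the letter
    before the word is U. *)
Lemma mem_peaks_aux h g s x y : g <= h ->
  (exists k, [/\ k < size s, nth stepR s k = stepR,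
     (if k is k'.+1 then nth stepR s k' = stepU else g < h) &
     (x, y) = (count_mem stepR (take k s), h + count_mem stepU (take k s))]) <->
  [/\ x < size (heights h s), nth 0 (heights h s) x = y &
      nth 0 (g :: heights h s) x < y].
Proof.
elim: s h g x y => [|b s IH] h g x y le_gh; first by split=> [[k []]|[]].
case: b => /=.
  rewrite -IH ?(leqW le_gh) //; split.
    case=> -[[_ //]|k [lt_k Rk Uk [-> ->]]]; exists k; split=> //.
      by case: (k) Uk => [|k'].
    by rewrite /= add0n addnS addSn.
  case=> k [lt_k Rk Uk [-> ->]]; exists k.+1; split=> //.
    by case: (k) Uk.
  by rewrite /= add0n addnS addSn.
split.
  case=> -[[_ _ lt_gh [-> ->]]|k [lt_k Rk Uk [-> ->]]]; first by rewrite /= addn0.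
  have [|lt_x eq_y lt_y] := (IH h h (count_mem stepR (take k s)) (h + count_mem stepU (take k s)) (leqnn h)).1.
    exists k; split=> //; first by case: (k) Uk.
  by rewrite /= !add1n add0n; split.
case: x => [|x] /= [lt_x eq_y lt_y].
  by exists 0; rewrite -eq_y addn0; split=> //; rewrite -eq_y in lt_y.
have [|k [lt_k Rk Uk [-> ->]]] := (IH h h x y (leqnn h)).2; first by [].
exists k.+1; split=> //; by case: (k) Uk => //; rewrite ltnn.
Qed.

Lemma mem_peaks s x y :
  (x, y) \in peaks s <->
  [/\ x < size (heights 0 s), nth 0 (heights 0 s) x = y &
      nth 0 (0 :: heights 0 s) x < y].
Proof.
rewrite -mem_peaks_aux //; split.
  case/mapP=> k; rewrite mem_filter mem_iota add0n => /andP[/andP[/eqP Uk /eqP Rk] lt_k] ->.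
  have lt_ks : k.+1 < size s by move: lt_k; case: (size s).
  exists k.+1; split=> //; first by rewrite -[RHS]Rk; apply: set_nth_default.
  by rewrite -[RHS]Uk; apply: set_nth_default; apply: ltnW.
case=> -[[] //|k [lt_k Rk Uk ->]]; apply/mapP; exists k => //.
rewrite mem_filter !(set_nth_default stepR stepU) ?(ltnW lt_k) // Rk Uk !eqxx mem_iota.
by rewrite /= add0n; case: (size s) lt_k.
Qed.

(** A point of the path determines the number of steps that lead to it. *)
Lemma point_sum s k : k <= size s -> (point s k).1 + (point s k).2 = k.
Proof.
move=> le_k; rewrite /point /= addnC.
rewrite (@eq_count _ (pred1 stepR) (predC (pred1 stepU))); last by case.
by rewrite count_predC size_take_min (minn_idPl le_k).
Qed.

Lemma uniq_peaks s : uniq (peaks s).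
Proof.
rewrite map_inj_in_uniq ?filter_uniq ?iota_uniq // => j k.
rewrite !mem_filter !mem_iota !add0n => /andP[_ lt_j] /andP[_ lt_k] eq_jk.
have lt_js : j < size s by case: (size s) lt_j => // m /ltnW.
have lt_ks : k < size s by case: (size s) lt_k => // m /ltnW.
by have := point_sum lt_js; rewrite eq_jk (point_sum lt_ks) => -[].
Qed.

(** * Rowmotion in terms of heights *)

(** The height over the strip from [i.-1] to [i]; the value [0] at [i = 0] makes
    the first strip a rise. *)
Definition height (n : nat) (p : dyck n) (i : nat) : nat :=
  nth 0 (0 :: heights 0 p) i.

Lemma size_heights_dyck n (p : dyck n) : size (heights 0 p) = n.
Proof. by have [_ cR _] := (is_dyckP _ _).1 (dyck_wordP p); rewrite size_heights. Qed.

Lemma height_gt n (p : dyck n) i : i < n -> i < height p i.+1.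
Proof.
move=> lt_i; have [_ _ bal] := (is_dyckP _ _).1 (dyck_wordP p).
by rewrite -[i in i < _]add0n; apply: heights_gt; rewrite ?size_heights_dyck.
Qed.

Lemma height_le n (p : dyck n) i : height p i <= n.
Proof.
have [cU _ _] := (is_dyckP _ _).1 (dyck_wordP p).
case: i => //= i; rewrite /height /=; have [lt_i|ge_i] := ltnP i n.
  have /allP le_n := heights_le 0 p; rewrite cU in le_n.
  by apply: le_n; rewrite mem_nth ?size_heights_dyck.
by rewrite nth_default // size_heights_dyck.
Qed.

Lemma leq_height n (p : dyck n) i j : i <= j <= n -> height p i <= height p j.
Proof.
case/andP=> le_ij le_jn; have : sorted leq (0 :: heights 0 p) by apply: path_heights.
move/(sorted_leq_nth leq_trans leqnn 0); apply => //.
  by rewrite inE /= size_heights_dyck ltnS (leq_trans le_ij).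
by rewrite inE /= size_heights_dyck ltnS.
Qed.

Lemma mem_path_filter n (p : dyck n) (b : 'I_n * 'I_n) :
  (b \in Defs.path_filter p) = (b.1 < b.2) && (height p b.1.+1 <= b.2).
Proof.
rewrite !inE; case: ltnP => //= _; have := @heights_leP 0 p b.1 b.2.
rewrite size_heights_dyck => /(_ (ltn_ord _)) iffH.
apply/forallP/idP => [le_b|/iffH le_b k]; last first.
  by apply/implyP; apply: le_b; rewrite size_tuple -ltnS.
apply/iffH => k le_k le_x.
have lt_k : k < n.*2.+1 by rewrite ltnS -(size_tuple (dyck_word p)).
by have /implyP := le_b (Ordinal lt_k); apply.
Qed.

Lemma path_filter_height n (p q : dyck n) : Defs.path_filter p = Defs.path_filter q ->
  forall i, i < n -> height p i.+1 <= height q i.+1.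
Proof.
move=> eqF i lt_i; have [-> |ne_n] := eqVneq (height q i.+1) n; first exact: height_le.
have lt_q : height q i.+1 < n by rewrite ltn_neqAle ne_n height_le.
have : (Ordinal lt_i, Ordinal lt_q) \in Defs.path_filter q.
  by rewrite mem_path_filter /= height_gt /=.
by rewrite -eqF mem_path_filter => /andP[].
Qed.

Definition is_valley (n : nat) (h : nat -> nat) (i : nat) : bool :=
  (i < n) && (h i < h i.+1).

(** Since heights increase, the last valley at abscissa at most [i] is the
    highest; the value is one more than its height, and [0] if there is none. *)
Fixpoint last_valley (n : nat) (h : nat -> nat) (i : nat) : nat :=
  if i is i'.+1 then
    if is_valley n h i'.+1 then (h i'.+1).+1 else last_valley n h i'
  else 0.

Lemma last_valley_leP n (p : dyck n) i y : i <= n ->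
  (last_valley n (height p) i <= y) <->
  (forall j, 0 < j <= i -> is_valley n (height p) j -> height p j < y).
Proof.
elim: i => [|i IH] lt_i /=; first by split=> // _ [|j] /andP[].
have {}IH := IH (ltnW lt_i).
have split_j j : 0 < j <= i.+1 -> j = i.+1 \/ 0 < j <= i.
  by case/andP=> ->; rewrite [j <= _]leq_eqVlt => /predU1P[|]; [left|right].
case: ifP => [val_i|nval_i].
  split=> [lt_y j /split_j[->//|/andP[_ le_ji]] _|]; last by apply=> //; rewrite leqnn.
  by apply: leq_ltn_trans lt_y; apply: leq_height; rewrite leqW.
split=> [/IH lt_y j /split_j[->|]|lt_y]; first by rewrite nval_i.
  exact: lt_y.
by apply/IH=> j /andP[j_gt0 le_ji]; apply: lt_y; rewrite j_gt0 leqW.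
Qed.

Lemma last_valley_le n (p : dyck n) i : i <= n ->
  last_valley n (height p) i <= (height p i).+1 /\ last_valley n (height p) i <= n.
Proof.
move=> le_i; split; apply/last_valley_leP => // j /andP[_ le_ji].
  by move=> _; rewrite ltnS leq_height ?le_ji.
by case/andP=> _ lt_h; apply: leq_trans lt_h (height_le _ _).
Qed.

Lemma last_valley_mono n (p : dyck n) i j : i <= j <= n ->
  last_valley n (height p) i <= last_valley n (height p) j.
Proof.
case/andP=> le_ij le_jn; apply/last_valley_leP; first exact: leq_trans le_jn.
move=> t /andP[t_gt0 le_ti].
have [/(_ (leqnn _))] := @last_valley_leP n p j (last_valley n (height p) j) le_jn.
by move=> lt_V _; apply: lt_V; rewrite t_gt0 (leq_trans le_ti).
Qed.

(** The minimal boxes above a path are those that sit in its valleys: any other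
    box of the filter has below it or to its right another one. *)
Lemma mem_minimal_boxes n (p : dyck n) (b : 'I_n * 'I_n) :
  (b \in minimal_boxes (Defs.path_filter p)) =
  is_valley n (height p) b.1.+1 && (height p b.1.+1 == b.2 :> nat).
Proof.
case: b => x y; rewrite inE mem_path_filter /=.
apply/idP/idP.
  case/andP=> /andP[lt_xy le_hy] /forallP min_b.
  have lt_hn : height p x.+1 < n := leq_ltn_trans le_hy (ltn_ord y).
  have eq_h : height p x.+1 = y.
    have := min_b (x, Ordinal lt_hn).
    rewrite mem_path_filter /box_le /= leqnn height_gt // leqnn le_hy /=.
    by move/eqP=> [] /(congr1 val).
  rewrite eq_h eqxx andbT /is_valley.
  have lt_xn : x.+1 < n.
    rewrite ltn_neqAle ltn_ord andbT; apply: contraTneq lt_hn => eq_n.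
    by rewrite -leqNgt -{1}eq_n height_gt.
  rewrite lt_xn ltnNge; apply/negP=> le_h.
  have lt_hy : height p x.+2 <= y by rewrite -eq_h.
  have := min_b (Ordinal lt_xn, y).
  rewrite mem_path_filter /box_le /= lt_hy (leq_trans (height_gt p lt_xn) lt_hy) leqnSn leqnn /=.
  by move/eqP=> [] /(congr1 val) /= eq_x; have := leqnn x; rewrite -{1}eq_x ltnn.
case/andP=> /andP[lt_xn lt_h] /eqP eq_h.
rewrite eq_h leqnn -eq_h height_gt //=; apply/forallP=> -[x' y'].
rewrite mem_path_filter /box_le /=; apply/implyP=> /andP[_ le_h].
apply/implyP=> /andP[le_x le_y]; move: le_x; rewrite leq_eqVlt => /predU1P[eq_x|lt_x].
  apply/eqP; congr (_, _); apply: val_inj => //=.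
  by apply/eqP; rewrite eqn_leq le_y -eq_h eq_x.
have := leq_height p (_ : x.+2 <= x'.+1 <= n); rewrite ltnS lt_x ltn_ord => /(_ isT) le_h'.
have := leq_trans lt_h (leq_trans le_h' (leq_trans le_h le_y)).
by rewrite eq_h ltnn.
Qed.

(** A box is outside the ideal when it is higher than all valleys weakly to its
    left. *)
Lemma rowmotion_filter n (p : dyck n) (b : 'I_n * 'I_n) :
  (b \in boxes n :\: box_ideal (minimal_boxes (Defs.path_filter p))) =
  (b.1 < b.2) && (last_valley n (height p) b.1.+1 <= b.2).
Proof.
case: b => x y; rewrite !inE /=; case: ltnP => [lt_xy|]; last by rewrite andbF.
rewrite /= andbT; have leP := @last_valley_leP n p x.+1 y (ltn_ord x).
apply/idP/idP => [/existsPn no_c|/leP le_y].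
  apply/leP => j /andP[j_gt0 le_jx] val_j.
  rewrite ltnNge; apply/negP=> le_yh; case/andP: (val_j) => lt_jn lt_h.
  have lt_hn : height p j < n by apply: leq_trans lt_h (height_le _ _).
  have lt_j1n : j.-1 < n by rewrite prednK // ltnW.
  have := no_c (Ordinal lt_j1n, Ordinal lt_hn).
  rewrite mem_minimal_boxes /= prednK // val_j eqxx /box_le /= le_yh andbT.
  by rewrite -ltnS (prednK j_gt0) le_jx.
apply/existsPn => -[x' y']; rewrite mem_minimal_boxes /box_le /=.
apply/negP=> /andP[/andP[val_x /eqP eq_h] /andP[le_x le_y']].
by have := le_y x'.+1 le_x val_x; rewrite eq_h ltnNge le_y'.
Qed.

(** The new path runs over all boxes of the ideal generated by the valley boxes,
    and over the lowest path. *)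
Definition rowmotion_height (n : nat) (h : nat -> nat) (i : nat) : nat :=
  maxn i (last_valley n h i).

(** The complement of the ideal is the filter of a path, so the default value in
    the definition of [rowmotion] is not taken. *)
Lemma rowmotion_path n (p : dyck n) :
  exists q : dyck n, forall i, i < n ->
    height q i.+1 = rowmotion_height n (height p) i.+1.
Proof.
pose l := [seq rowmotion_height n (height p) i | i <- iota 1 n].
have sz_l : size l = n by rewrite size_map size_iota.
have nth_l i : i < n -> nth 0 l i = rowmotion_height n (height p) i.+1.
  by move=> lt_i; rewrite (nth_map 0) ?size_iota // nth_iota.
have le_l : all (leq^~ n) l.
  apply/allP=> y /mapP[i]; rewrite mem_iota add1n ltnS => /andP[_ le_i] ->.
  by rewrite geq_max le_i; have [] := last_valley_le p le_i.
have path_l : path leq 0 l.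
  have : sorted leq l.
    apply/(sortedP 0) => i; rewrite sz_l => lt_i; rewrite !nth_l ?(ltnW lt_i) //.
    rewrite geq_max; apply/andP; split; first by rewrite leq_max leqnSn.
    by rewrite leq_max orbC (last_valley_mono p (j := i.+2)) // leqnSn.
  by case: (l).
have last_l : 0 < n -> last 0 l = n.
  move=> n_gt0; rewrite -nth_last sz_l nth_l ?prednK //.
  by apply/eqP; rewrite eqn_leq leq_maxl andbT geq_max leqnn; have [] := last_valley_le p (leqnn n).
have dy : is_dyck n (of_heights 0 l).
  have [cU cR] := count_of_heights path_l.
  apply/is_dyckP; split.
  - rewrite cU subn0; case: (posnP n) => [n0|/last_l//].
    by rewrite (size0nil (etrans sz_l n0)).
  - by rewrite cR sz_l.
  move=> k; have := @ballot_of_heights 0 0 l k path_l (leqnn 0); rewrite !add0n; apply.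
  by move=> x; rewrite sz_l => lt_x; rewrite nth_l // leq_max leqnn.
have sz : size (of_heights 0 l) == n.*2 by rewrite (size_dyck dy).
exists (@Dyck n (Tuple sz) dy) => i lt_i.
by rewrite /height /= of_heightsK // nth_l.
Qed.

Lemma height_rowmotion n (p : dyck n) i : i < n ->
  height (rowmotion p) i.+1 = rowmotion_height n (height p) i.+1.
Proof.
have [q0 hq0] := rowmotion_path p.
have filter_q0 : Defs.path_filter q0 =
    boxes n :\: box_ideal (minimal_boxes (Defs.path_filter p)).
  apply/setP=> b; rewrite rowmotion_filter mem_path_filter hq0 // geq_max.
  by case: (ltnP b.1 b.2).
rewrite /rowmotion; case: pickP => [q /eqP filter_q lt_i|/(_ q0)]; last by rewrite filter_q0 eqxx.
rewrite /= -hq0 //; apply/eqP; rewrite eqn_leq.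
by rewrite !path_filter_height // filter_q filter_q0.
Qed.

(** The new height rises above the lowest path exactly where a new valley becomes
    the last one, and then to one more than the height of that valley. *)
Lemma rowmotion_peak n (p : dyck n) i : 0 < i <= n ->
  (height (rowmotion p) i.-1 < height (rowmotion p) i) && (i < height (rowmotion p) i) =
    is_valley n (height p) i /\
  (is_valley n (height p) i -> height (rowmotion p) i = (height p i).+1).
Proof.
case: i => // i /andP[_ lt_i].
have eqV : is_valley n (height p) i.+1 ->
    height (rowmotion p) i.+1 = (height p i.+1).+1.
  move=> val_i; rewrite height_rowmotion // /rowmotion_height /= val_i.
  by apply/maxn_idPr; rewrite ltnS ltnW // height_gt.
split=> //; case: (boolP (is_valley n (height p) i.+1)) => [val_i|/negPf nval].
  rewrite eqV // [i.+1 < _]ltnS height_gt // andbT ltnS.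
  case: i lt_i val_i {eqV} => // i lt_i val_i.
  rewrite height_rowmotion ?(ltnW lt_i) // geq_max ltnW ?height_gt //=.
  apply/(@last_valley_leP n p i.+1); first exact: ltnW.
  move=> j /andP[_ le_ji] /andP[_ lt_h]; apply: leq_trans lt_h _.
  by rewrite leq_height // ltnS le_ji.
apply/negP=> /andP[lt_h lt_ih].
have eq_h : height (rowmotion p) i.+1 = last_valley n (height p) i.
  move: lt_ih; rewrite height_rowmotion // /rowmotion_height /= nval.
  by rewrite leq_max ltnn /= => /ltnW/maxn_idPr.
case: i lt_i lt_h lt_ih eq_h {nval eqV} => [|i] lt_i lt_h lt_ih eq_h.
  by rewrite eq_h in lt_ih.
move: lt_h; rewrite eq_h height_rowmotion ?(ltnW lt_i) //=.
by rewrite ltnNge leq_maxr.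
Qed.

(** * The entries of a 321-avoiding permutation *)

Lemma card_ord_ltn (n m : nat) : m <= n -> #|[set k : 'I_n | k < m]| = m.
Proof.
move=> le_mn; rewrite cardsE cardE -(size_map val) /enum_mem -enumT.
rewrite (eq_filter (a2 := preim val (gtn m))); last by [].
rewrite -filter_map val_enum_ord size_filter -(subnKC le_mn) iotaD count_cat.
rewrite (@eq_in_count _ _ predT) ?count_predT ?size_iota; last first.
  by move=> i; rewrite mem_iota.
rewrite (@eq_in_count _ _ pred0) ?count_pred0 ?addn0 //.
by move=> i; rewrite mem_iota /= => /andP[le_mi _]; rewrite ltnNge le_mi.
Qed.

Lemma card_perm_ltn (n m : nat) (w : {perm 'I_n}) :
  m <= n -> #|[set k : 'I_n | w k < m]| = m.
Proof.
move=> le_mn; rewrite -[RHS](card_ord_ltn le_mn).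
rewrite -(card_preimset [set k : 'I_n | k < m] (@perm_inj _ w)).
by apply: eq_card => k; rewrite !inE.
Qed.

Lemma avoids321P (n : nat) (w : {perm 'I_n}) (i j k : 'I_n) :
  avoids321 w -> i < j -> j < k -> w j < w i -> w k < w j -> False.
Proof.
move=> av lt_ij lt_jk lt1 lt2.
by have /forallP/(_ j)/forallP/(_ k) := forallP av i; rewrite lt_ij lt_jk lt1 lt2.
Qed.

(** If w_i > w_j, then by the avoidance of 321 all smaller values than w_j, of
    which there are at least j, would be taken at positions before j and
    different from i, of which there are only j - 1 (counting from 0). *)
Lemma avoids321_exc (n : nat) (w : {perm 'I_n}) (i j : 'I_n) :
  avoids321 w -> i < j -> j <= w j -> w i < w j.
Proof.
move=> av lt_ij le_jw; rewrite ltn_neqAle; apply/andP; split.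
  by apply: contraTneq lt_ij => /val_inj/perm_inj ->; rewrite ltnn.
rewrite leqNgt; apply/negP=> lt_w.
have : [set k : 'I_n | w k < w j] \subset [set k : 'I_n | k < j] :\ i.
  apply/subsetP=> k; rewrite !inE => lt_k; rewrite ltnNge.
  have -> /= : k != i by apply: contraTneq lt_k => ->; rewrite -leqNgt ltnW.
  rewrite leq_eqVlt; apply/norP; split.
    by apply: contraTneq lt_k => /val_inj ->; rewrite ltnn.
  by apply/negP=> lt_jk; apply: (avoids321P av lt_ij lt_jk).
move/subset_leq_card; rewrite card_perm_ltn ?(ltnW (ltn_ord _)) //.
have := cardsD1 i [set k : 'I_n | k < j].
rewrite card_ord_ltn ?(ltnW (ltn_ord _)) // inE lt_ij; lia.
Qed.

(** Dually, if w_i > w_j, then no entry before i exceeds w_i, so the i entries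
    before i and the entry at j have values below w_i; these are more than w_i. *)
Lemma avoids321_nexc (n : nat) (w : {perm 'I_n}) (i j : 'I_n) :
  avoids321 w -> i < j -> w i <= i -> w i < w j.
Proof.
move=> av lt_ij le_wi; rewrite ltn_neqAle; apply/andP; split.
  by apply: contraTneq lt_ij => /val_inj/perm_inj ->; rewrite ltnn.
rewrite leqNgt; apply/negP=> lt_w.
have : j |: [set k : 'I_n | k < i] \subset [set k : 'I_n | w k < w i].
  apply/subsetP=> k; rewrite !inE => /predU1P[->//|lt_ki].
  rewrite ltnNge leq_eqVlt; apply/norP; split.
    by apply: contraTneq lt_ki => /val_inj/perm_inj <-; rewrite ltnn.
  by apply/negP=> lt_wk; apply: (avoids321P av lt_ki lt_ij).
move/subset_leq_card; rewrite cardsU1 inE ltnNge (ltnW lt_ij) /= card_ord_ltn ?(ltnW (ltn_ord _)) //.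
rewrite card_perm_ltn ?(ltnW (ltn_ord _)) //; lia.
Qed.

Definition value (n : nat) (w : {perm 'I_n}) (i : nat) : nat := nth 0 (one_line w) i.-1.

Lemma size_one_line n (w : {perm 'I_n}) : size (one_line w) = n.
Proof. by rewrite size_map size_enum_ord. Qed.

Lemma value_ord n (w : {perm 'I_n}) (i : 'I_n) : value w i.+1 = (w i).+1.
Proof. by rewrite /value (nth_map i) ?size_enum_ord //= nth_ord_enum. Qed.

Lemma one_lineE n (w : {perm 'I_n}) : one_line w = map (value w) (iota 1 n).
Proof.
apply: (@eq_from_nth _ 0); rewrite size_one_line ?size_map ?size_iota // => i lt_i.
by rewrite (nth_map 0) ?size_iota // nth_iota.
Qed.

Lemma entries_one_line n (w : {perm 'I_n}) :
  entries (one_line w) = [seq (i, value w i) | i <- iota 1 n].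
Proof.
rewrite /entries size_one_line one_lineE.
by elim: (iota 1 n) => //= i s ->.
Qed.

Lemma perm_one_line n (w : {perm 'I_n}) : perm_eq (one_line w) (iota 1 n).
Proof.
have uw : uniq (one_line w).
  rewrite map_inj_uniq ?enum_uniq // => i j [] /val_inj; exact: perm_inj.
apply: uniq_perm => //; first exact: iota_uniq.
apply: (uniq_min_size uw _ _).2; last by rewrite size_one_line size_iota.
by move=> x /mapP[i _ ->]; rewrite mem_iota /= add1n !ltnS ltn_ord.
Qed.

(** Fixed points can be counted among the uppers or among the lowers; weak and
    strict excedances are both used below. *)
Lemma shuffle_one_line n (w : {perm 'I_n}) (u : pred entry) :
  avoids321 w -> (forall x, u x -> x.1 <= x.2) -> (forall x, ~~ u x -> x.2 <= x.1) ->
  pairwise (shuffle_rel u) (entries (one_line w)).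
Proof.
move=> av u1 u2; rewrite entries_one_line pairwise_map.
have : pairwise ltn (iota 1 n) by rewrite -(sorted_pairwise ltn_trans) iota_ltn_sorted.
apply: (@sub_in_pairwise _ (mem (iota 1 n)) ltn); last exact/allP.
move=> i j; rewrite !mem_iota !add1n !ltnS => /andP[i_gt0 le_i] /andP[j_gt0 le_j] lt_ij.
case: i i_gt0 le_i lt_ij => // i _ lt_in; case: j j_gt0 le_j => // j _ lt_jn lt_ij.
have [ui uj] := (u1 (i.+1, value w i.+1), u1 (j.+1, value w j.+1)).
have [vi vj] := (u2 (i.+1, value w i.+1), u2 (j.+1, value w j.+1)).
move: ui uj vi vj; rewrite /shuffle_rel /=.
rewrite (value_ord w (Ordinal lt_in)) (value_ord w (Ordinal lt_jn)) /= => ui uj vi vj.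
have {}lt_ij : i < j by [].
rewrite ltnS lt_ij eqSS /=; apply/andP; split.
  by apply: contraTneq lt_ij => /val_inj/perm_inj [->]; rewrite ltnn.
apply/implyP=> uij; rewrite ltnS.
case: (boolP (u (j.+1, (w (Ordinal lt_jn)).+1))) => [/uj|nuj].
  by apply: avoids321_exc.
move: uij; rewrite (negPf nuj) implybF => /vi le_wi.
exact: (@avoids321_nexc n w (Ordinal lt_in) (Ordinal lt_jn)).
Qed.

Lemma excedance_height n (w : {perm 'I_n}) (p : dyck n) i :
  is_path_of_perm w p -> 0 < i <= n ->
  (i <= value w i) = (height p i.-1 < height p i) /\
  (i <= value w i -> value w i = height p i).
Proof.
move=> perm_p; case: i => // i lt_i.
have mem_exc y : (i, y) \in excedance_points (one_line w) =
    (i.+1 <= value w i.+1) && (value w i.+1 == y).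
  apply/mapP/andP.
    case=> j; rewrite mem_filter mem_iota => /andP[le_j /andP[j_gt0 _]] [def_i ->].
    by move: le_j; rewrite def_i prednK // /value /= eqxx.
  case=> le_i /eqP <-; exists i.+1 => //.
  by rewrite mem_filter mem_iota le_i /= size_one_line.
have mem_pk y : (i, y) \in peaks p <-> height p i.+1 = y /\ height p i < y.
  rewrite mem_peaks size_heights_dyck; split; first by case.
  by case; split.
have eq_mem y : (i, y) \in peaks p = ((i, y) \in excedance_points (one_line w)).
  exact: (perm_mem perm_p).
have exc_h : i < value w i.+1 -> height p i.+1 = value w i.+1 /\ height p i < value w i.+1.
  by move=> le_i; apply/mem_pk; rewrite eq_mem mem_exc le_i eqxx.
split; last by case/exc_h.
apply/idP/idP => [/exc_h[-> //]|lt_h].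
have : (i, height p i.+1) \in peaks p by apply/mem_pk.
by rewrite eq_mem mem_exc => /andP[].
Qed.

(** * The 321-avoiding permutation of a path *)

Lemma index_sorted_count (s : seq nat) (x : nat) :
  sorted ltn s -> x \in s -> index x s = count (gtn x) s.
Proof.
elim: s => //= y s IH path_s; rewrite inE eq_sym; case: eqVneq path_s => [<-|ne_xy] path_s /= x_s.
  rewrite ltnn /=; apply/esym/eqP; rewrite -leqn0 leqNgt -has_count; apply/hasPn=> z z_s.
  by rewrite /= -leqNgt; apply/ltnW/(allP (order_path_min ltn_trans path_s)).
have /= -> := allP (order_path_min ltn_trans path_s) _ x_s.
by rewrite IH // (path_sorted path_s).
Qed.

Lemma nth_lt_count (s : seq nat) (x j : nat) :
  sorted ltn s -> j < count (gtn x) s -> nth 0 s j < x.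
Proof.
elim: s j => //= y s IH j path_s; case: (ltnP y x) => [lt_yx|le_xy] /=.
  by case: j => [|j] //=; rewrite add1n ltnS; apply: IH; apply: path_sorted path_s.
rewrite add0n (_ : count _ s = 0) //; apply/eqP; rewrite -leqn0 leqNgt -has_count.
apply/hasPn=> z z_s; rewrite /= -leqNgt (leq_trans le_xy) //.
by apply/ltnW/(allP (order_path_min ltn_trans path_s)).
Qed.

Lemma count_iota_ltn (a : pred nat) (i n : nat) : 0 < i <= n.+1 ->
  count (gtn i) (filter a (iota 1 n)) = count a (iota 1 i.-1).
Proof.
case: i => // i /andP[_ le_in]; rewrite count_filter -(subnKC (_ : i <= n)) //.
rewrite iotaD count_cat; set b := predI _ _.
have -> : count b (iota 1 i) = count a (iota 1 i).
  by apply: eq_in_count => j; rewrite mem_iota /b /= add1n => /andP[_ ->].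
have -> : count b (iota (1 + i) (n - i)) = count pred0 (iota (1 + i) (n - i)).
  apply: eq_in_count => j; rewrite mem_iota /b /= add1n => /andP[lt_ij _].
  by rewrite ltnNge lt_ij.
by rewrite count_pred0 addn0.
Qed.

Definition rises (h : nat -> nat) (i : nat) : bool := h i.-1 < h i.

Lemma rises_lt n (p : dyck n) i j :
  i < j <= n -> rises (height p) j -> height p i < height p j.
Proof.
case: j => // j /andP[lt_ij lt_jn]; apply: leq_ltn_trans.
by apply: leq_height; rewrite /= -ltnS lt_ij ltnW.
Qed.

(** The height is constant back to the rise at which it is first attained. *)
Lemma first_rise n (p : dyck n) k : 0 < k <= n ->
  exists a, [/\ 0 < a <= k, rises (height p) a & height p a = height p k].
Proof.
elim: k => // k IH lt_kn; case: (boolP (rises (height p) k.+1)) => [rise|].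
  by exists k.+1; rewrite leqnn.
rewrite /rises -leqNgt /= => le_h.
have eq_h : height p k.+1 = height p k.
  by apply/eqP; rewrite eqn_leq le_h leq_height // leqnSn.
case: k IH lt_kn le_h eq_h => [|k] IH lt_kn le_h eq_h.
  by have := height_gt p lt_kn; rewrite eq_h.
have [|a [/andP[a_gt0 le_ak] rise eq_a]] := IH; first exact: ltnW.
by exists a; split=> //; [rewrite a_gt0 leqW | rewrite eq_h].
Qed.

(** The rises carry the heights as values, and the other positions carry the
    remaining values in increasing order.  A position [i] that is not a rise gets
    a value below [i]: its height, at least [i], is attained at an earlier rise,
    so among the values of the rises before [i] at least one is not below [i],
    and more unused values than unused positions lie below [i]. *)
Lemma exists_perm_of_path n (p : dyck n) :
  exists w : {perm 'I_n}, avoids321 w && is_path_of_perm w p.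
Proof.
pose h := height p; pose m := rises h.
pose as0 := filter m (iota 1 n); pose bs := map h as0.
pose cs := filter (predC m) (iota 1 n); pose ds := filter [predC bs] (iota 1 n).
pose v i := if m i then h i else nth 0 ds (index i cs).
have hP i : 0 < i <= n -> i <= h i <= n.
  by case: i => // i lt_in; rewrite height_le height_gt.
have bsP b : b \in bs -> exists i, [/\ 0 < i <= n, m i & b = h i].
  case/mapP=> i; rewrite mem_filter mem_iota add1n ltnS => /andP[mi le_i] ->.
  by exists i.
have mem_bs i : 0 < i <= n -> m i -> h i \in bs.
  by move=> le_i mi; apply: map_f; rewrite mem_filter mi mem_iota add1n ltnS.
have h_inj i j : 0 < i <= n -> 0 < j <= n -> m i -> m j -> h i = h j -> i = j.
  move=> /andP[_ le_i] /andP[_ le_j] mi mj eq_h; case: (ltngtP i j) => // lt_ij.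
    by have := @rises_lt n p i j; rewrite lt_ij le_j -/h eq_h ltnn => /(_ isT mj).
  by have := @rises_lt n p j i; rewrite lt_ij le_i -/h eq_h ltnn => /(_ isT mi).
have bs_uniq : uniq bs.
  rewrite map_inj_in_uniq ?filter_uniq ?iota_uniq // => i j.
  rewrite !mem_filter !mem_iota !add1n !ltnS => /andP[mi le_i] /andP[mj le_j].
  exact: h_inj.
have sz_cs : size cs = size ds.
  have eq1 := count_predC m (iota 1 n); have eq2 := count_predC [in bs] (iota 1 n).
  rewrite !size_filter; rewrite size_iota in eq1 eq2.
  have : count [in bs] (iota 1 n) = count m (iota 1 n).
    rewrite count_mem_iota // ?size_map ?size_filter // => b /bsP[i [le_i _ ->]].
    by have /andP[le_ih ->] := hP i le_i; case/andP: le_i => i_gt0 _; rewrite (leq_trans i_gt0).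
  by move=> eq3; apply/eqP; rewrite -(eqn_add2l (count m (iota 1 n))) eq1 -eq3 eq2.
have cs_sorted : sorted ltn cs by apply: (sorted_filter ltn_trans); apply: iota_ltn_sorted.
have ds_sorted : sorted ltn ds by apply: (sorted_filter ltn_trans); apply: iota_ltn_sorted.
have mem_cs i : 0 < i <= n -> ~~ m i -> i \in cs.
  by move=> le_i nmi; rewrite mem_filter /= nmi mem_iota add1n ltnS.
have v_ds i : 0 < i <= n -> ~~ m i -> v i \in ds.
  by move=> le_i nmi; rewrite /v (negPf nmi) mem_nth // -sz_cs index_mem mem_cs.
have v_lt i : 0 < i <= n -> ~~ m i -> v i < i.
  move=> le_i nmi; rewrite /v (negPf nmi); apply: nth_lt_count => //.
  have le_i' : 0 < i <= n.+1 by case/andP: le_i => -> /leqW.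
  rewrite index_sorted_count ?mem_cs // !count_iota_ltn //.
  have eq1 := count_predC m (iota 1 i.-1); have eq2 := count_predC [in bs] (iota 1 i.-1).
  suff : count [in bs] (iota 1 i.-1) < count m (iota 1 i.-1).
    by rewrite -(ltn_add2r (count (predC m) (iota 1 i.-1))) eq1 -eq2 ltn_add2l.
  rewrite -!size_filter -(size_map h (filter m _)).
  have [a [/andP[a_gt0 le_ai] ma eq_a]] := first_rise p le_i.
  have lt_ai : a < i.
    by rewrite ltn_neqAle le_ai andbT; apply: contraNneq nmi => <-.
  apply: (@uniq_leq_size _ (h i :: filter [in bs] (iota 1 i.-1))).
    rewrite /= filter_uniq ?iota_uniq // andbT mem_filter mem_iota negb_and orbC.
    have /andP[i_gt0 _] := le_i; rewrite add1n prednK // negb_and -leqNgt.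
    by rewrite -[~~ (_ < _)]leqNgt; have /andP[-> _] := hP i le_i; rewrite orbT.
  move=> b; rewrite inE => /predU1P[->|].
    apply/mapP; exists a => //; rewrite mem_filter; apply/andP; split=> //.
    by rewrite mem_iota a_gt0 add1n prednK // (leq_trans a_gt0).
  rewrite mem_filter mem_iota add1n => /andP[/bsP[j [le_j mj ->]] /andP[_ lt_hj]].
  apply: map_f; rewrite mem_filter mj mem_iota add1n; case/andP: (le_j) => -> _ /=.
  by apply: leq_ltn_trans lt_hj; case/andP: (hP j le_j).
have v_ge i : 0 < i <= n -> m i -> i <= v i.
  by move=> le_i mi; rewrite /v mi; case/andP: (hP i le_i).
have v_range i : 0 < i <= n -> 0 < v i <= n.
  move=> le_i; case: (boolP (m i)) => mi.
    by case/andP: le_i (hP i le_i) => i_gt0 le_i; rewrite /v mi => /andP[/(leq_trans i_gt0)->].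
  by have := v_ds i le_i mi; rewrite mem_filter mem_iota add1n ltnS => /andP[_].
have v_low i j : 0 < i -> i < j -> j <= n -> ~~ m i -> ~~ m j -> v i < v j.
  move=> i_gt0 lt_ij le_jn mi mj; rewrite /v (negPf mi) (negPf mj).
  have i_cs : i \in cs by rewrite mem_cs // i_gt0 (leq_trans (ltnW lt_ij)).
  have j_cs : j \in cs by rewrite mem_cs // le_jn andbT (leq_trans i_gt0 (ltnW lt_ij)).
  apply: (sorted_ltn_nth ltn_trans 0 ds_sorted); rewrite ?inE -?sz_cs ?index_mem //.
  rewrite ltnNge; apply: contraL lt_ij => le_idx; rewrite -leqNgt.
  rewrite -(nth_index 0 i_cs) -(nth_index 0 j_cs).
  have /(sorted_leq_nth leq_trans leqnn 0) : sorted leq cs.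
    by apply: sub_sorted cs_sorted => x y /ltnW.
  by apply; rewrite ?inE ?index_mem.
have v_up i j : 0 < i -> i < j -> j <= n -> m j -> v i < v j.
  move=> i_gt0 lt_ij le_jn mj; have le_j : 0 < j <= n by rewrite (leq_trans i_gt0 (ltnW lt_ij)).
  have le_i : 0 < i <= n by rewrite i_gt0 (leq_trans (ltnW lt_ij)).
  case: (boolP (m i)) => mi; first by rewrite /v mi mj rises_lt // lt_ij.
  apply: leq_trans (v_ge j le_j mj); exact: ltn_trans (v_lt i le_i mi) lt_ij.
have v_inj i j : 0 < i <= n -> 0 < j <= n -> v i = v j -> i = j.
  have ne i' j' : 0 < i' <= n -> 0 < j' <= n -> i' < j' -> v i' != v j'.
    move=> /andP[i_gt0 le_i] /andP[j_gt0 le_j] lt_ij.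
    case: (boolP (m j')) => mj; first by rewrite ltn_eqF // v_up.
    case: (boolP (m i')) => mi; last by rewrite ltn_eqF // v_low.
    have := v_ds j'; rewrite j_gt0 le_j mj => /(_ isT isT).
    rewrite mem_filter /= => /andP[+ _]; apply: contraNneq => <-.
    by rewrite /v mi mem_bs // i_gt0.
  move=> le_i le_j eq_v; case: (ltngtP i j) => // lt_ij.
    by have := ne i j le_i le_j lt_ij; rewrite eq_v eqxx.
  by have := ne j i le_j le_i lt_ij; rewrite eq_v eqxx.
have ord_range (i : 'I_n) : 0 < i.+1 <= n := ltn_ord i.
have lt_v (i : 'I_n) : (v i.+1).-1 < n.
  by have /andP[v_gt0] := v_range i.+1 (ord_range i); rewrite prednK.
pose g (i : 'I_n) := Ordinal (lt_v i).
have g_inj : injective g.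
  move=> i j /(congr1 (fun k : 'I_n => k.+1)) /=.
  have /andP[vi _] := v_range i.+1 (ord_range i).
  have /andP[vj _] := v_range j.+1 (ord_range j).
  rewrite !prednK // => /(v_inj _ _ (ord_range i) (ord_range j)) [].
  exact: val_inj.
pose w := perm g_inj.
have value_w i : 0 < i <= n -> value w i = v i.
  case: i => // i lt_in; rewrite (value_ord w (Ordinal lt_in)) permE /=.
  by rewrite prednK //; have /andP[] := v_range i.+1 lt_in.
exists w; apply/andP; split.
  apply/forallP=> i; apply/forallP=> j; apply/forallP=> k; apply/negP.
  case/and4P=> lt_ij lt_jk lt_ji lt_kj.
  have lt_v' (a b : 'I_n) : w a < w b -> v a.+1 < v b.+1.
    by move=> lt_ab; rewrite -!value_w ?ord_range // !value_ord.
  have lt1 := lt_v' _ _ lt_ji; have lt2 := lt_v' _ _ lt_kj.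
  case: (boolP (m j.+1)) => mj.
    by have := v_up i.+1 j.+1 isT lt_ij (ord_range j) mj; rewrite ltnNge ltnW.
  case: (boolP (m k.+1)) => mk.
    by have := v_up j.+1 k.+1 isT lt_jk (ord_range k) mk; rewrite ltnNge ltnW.
  by have := v_low j.+1 k.+1 isT lt_jk (ord_range k) mj mk; rewrite ltnNge ltnW.
apply: uniq_perm; first exact: uniq_peaks.
  rewrite map_inj_in_uniq ?filter_uniq ?iota_uniq // => i j.
  rewrite !mem_filter !mem_iota => /and3P[_ i_gt0 _] /and3P[_ j_gt0 _] [eq_ij _].
  by rewrite -(prednK i_gt0) eq_ij prednK.
move=> [x y]; apply/idP/mapP.
  move/mem_peaks; rewrite size_heights_dyck => -[lt_x eq_y lt_y].
  have mx : m x.+1 by rewrite /m /rises /h /= /height /= eq_y.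
  exists x.+1; last first.
    by rewrite -/(value w x.+1) value_w // /v mx /h /height /= eq_y.
  rewrite mem_filter -/(value w x.+1) value_w // v_ge // mem_iota size_one_line add1n.
  exact: lt_x.
case=> i; rewrite mem_filter mem_iota size_one_line add1n ltnS.
case: i => // i /andP[le_v lt_i] [-> ->].
rewrite -/(value w i.+1) value_w // in le_v *.
have mi : m i.+1.
  by apply: contraLR le_v => mi; rewrite -ltnNge v_lt.
by apply/mem_peaks; rewrite size_heights_dyck /v mi; split.
Qed.

(** * Rowmotion on permutations and the two tableaux *)

Lemma iotaS (m n : nat) : iota m.+1 n = map S (iota m n).
Proof. exact: (iotaDl 1 m n). Qed.

Lemma filter_valleys (a : pred bool) n (p : dyck n.+1) :
  filter (fun i => a (is_valley n.+1 (height p) i)) (iota 1 n.+1) =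
    filter (fun i => a (rises (height p) i.+1)) (iota 1 n) ++
    (if a false then [:: n.+1] else [::]).
Proof.
rewrite iota_rcons filter_rcons add1n /is_valley ltnn /=.
have -> : [seq i <- iota 1 n | a ((i < n.+1) && (height p i < height p i.+1))] =
          [seq i <- iota 1 n | a (rises (height p) i.+1)].
  by apply: eq_in_filter => i; rewrite mem_iota add1n => /andP[_ ->].
by case: (a false); rewrite ?cats1 ?cats0.
Qed.

(** The rises after the first strip end the runs of constant height, so they
    follow the valleys. *)
Lemma filter_rises n (p : dyck n.+1) :
  filter (rises (height p)) (iota 1 n.+1) =
    1 :: map S (filter (is_valley n.+1 (height p)) (iota 1 n.+1)).
Proof.
rewrite (@filter_valleys id) cats0 [LHS]/= {1}/rises /= (height_gt p (ltn0Sn n)).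
by rewrite iotaS filter_map.
Qed.

Lemma filter_not_rises n (p : dyck n.+1) :
  rcons (filter (predC (rises (height p))) (iota 1 n.+1)) n.+2 =
    map S (filter (predC (is_valley n.+1 (height p))) (iota 1 n.+1)).
Proof.
rewrite (@filter_valleys negb) map_cat -cats1 [iota 1 n.+1]/=.
by rewrite /= {1}/rises /= (height_gt p (ltn0Sn n)) iotaS filter_map.
Qed.

(** Each run of constant height is listed at its first strip on one side and at
    its last strip on the other. *)
Lemma heights_of_rises n (p : dyck n) k : k < n ->
  map (height p) (filter (rises (height p)) (iota 1 k.+1)) =
  rcons (map (height p) (filter (fun i => rises (height p) i.+1) (iota 1 k)))
    (height p k.+1).
Proof.
elim: k => [|k IH] lt_kn.
  by rewrite /= /rises /= (leq_trans _ (height_gt p lt_kn)).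
rewrite iota_rcons [in RHS]iota_rcons !filter_rcons !add1n.
case: ifP => [_|/negbT]; first by rewrite !map_rcons IH // ltnW.
rewrite /rises -leqNgt /= => le_h; rewrite IH ?(ltnW lt_kn) //; congr rcons.
by apply/eqP; rewrite eqn_leq le_h leq_height // leqnSn.
Qed.

Lemma sorted_shuffle (u : pred entry) (r : seq entry) :
  pairwise (shuffle_rel u) r ->
  sorted ltn (unzip2 (filter u r)) /\ sorted ltn (unzip2 (filter (predC u) r)).
Proof.
move=> ok_r; rewrite !(sorted_pairwise ltn_trans) !pairwise_map.
split; [set v := u | set v := predC u].
  apply: (@sub_in_pairwise _ v (shuffle_rel u)); last exact: pairwise_filter.
    by move=> x y; rewrite !unfold_in => ux uy /and3P[_ _]; rewrite ux uy.
  exact: filter_all.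
apply: (@sub_in_pairwise _ v (shuffle_rel u)); last exact: pairwise_filter.
  by move=> x y; rewrite !unfold_in /= => /negPf ux uy /and3P[_ _]; rewrite ux.
exact: filter_all.
Qed.

Definition weak_exc (x : entry) : bool := x.1 <= x.2.
Definition strict_exc (x : entry) : bool := x.1 < x.2.

Lemma weak_shuffle n (w : {perm 'I_n}) :
  avoids321 w -> pairwise (shuffle_rel weak_exc) (entries (one_line w)).
Proof.
by move=> av; apply: shuffle_one_line => // x; rewrite /weak_exc // -ltnNge => /ltnW.
Qed.

Lemma strict_shuffle n (w : {perm 'I_n}) :
  avoids321 w -> pairwise (shuffle_rel strict_exc) (entries (one_line w)).
Proof.
move=> av; apply: shuffle_one_line => // x; rewrite /strict_exc; first exact: ltnW.
by rewrite -leqNgt.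
Qed.

Lemma perm_split (u : pred entry) n (w : {perm 'I_n}) :
  let r := entries (one_line w) in
  perm_eq (unzip1 (filter u r) ++ unzip1 (filter (predC u) r)) (iota 1 n) /\
  perm_eq (unzip2 (filter u r) ++ unzip2 (filter (predC u) r)) (iota 1 n).
Proof.
move=> r; rewrite /unzip1 /unzip2 -!map_cat; split.
  rewrite (perm_trans (perm_map _ (permEl (perm_filterC u r)))) //.
  by rewrite -/(unzip1 r) unzip1_zip ?size_iota // size_one_line.
rewrite (perm_trans (perm_map _ (permEl (perm_filterC u r)))) //.
by rewrite -/(unzip2 r) unzip2_zip ?size_iota // perm_one_line.
Qed.

Lemma RSK_steps_dyck n (w : {perm 'I_n}) :
  avoids321 w -> is_dyck n (RSK_steps (one_line w)).
Proof.
move=> av; have ok := weak_shuffle av.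
rewrite (RSK_steps_greedy (perm_one_line w) ok) /greedy_split.
set us := filter _ _; set ls := filter _ _; set M := greedy us ls.
have [perm1 perm2] := perm_split weak_exc w; rewrite -/us -/ls in perm1 perm2.
have sub1 : subseq [seq m.1 | m <- M] us := subseq_greedy1 us ls.
have sub2 : subseq [seq m.2 | m <- M] ls := subseq_greedy2 us ls.
have sub_v : subseq (bumped M ++ [seq m.2.2 | m <- M]) (unzip2 us ++ unzip2 ls).
  apply: cat_subseq; first by rewrite /bumped (map_comp snd fst) map_subseq.
  by rewrite (map_comp snd snd) map_subseq.
have sub_c : subseq (bumping M) (unzip1 ls).
  by rewrite /bumping (map_comp fst snd) map_subseq.
have sub_a : subseq [seq m.1.1 | m <- M] (unzip1 us).
  by rewrite (map_comp fst fst) map_subseq.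
have uniq1 : uniq (unzip1 us ++ unzip1 ls) by rewrite (perm_uniq perm1) iota_uniq.
apply: step_word_dyck.
- by apply: subseq_uniq sub_v _; rewrite (perm_uniq perm2) iota_uniq.
- rewrite uniq_catC; apply: subseq_uniq uniq1; exact: cat_subseq.
- move=> x; rewrite mem_cat => /orP[/(mem_subseq sub_v)|x_in].
    exact: perm_iota_range perm2.
  apply: (perm_iota_range perm1); rewrite mem_cat orbC; move: x_in; rewrite mem_cat.
  by case/orP=> [/(mem_subseq sub_c)->|/(mem_subseq sub_a)->]; rewrite ?orbT.
by move=> m /greedy_edge.
Qed.

Lemma zip_map_graph (f : nat -> nat) (s : seq nat) :
  zip s (map f s) = [seq (i, f i) | i <- s].
Proof. by elim: s => //= i s ->. Qed.

Lemma filter_entries n (w : {perm 'I_n}) (u : pred entry) (a : pred nat) (f : nat -> nat) :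
  (forall i, 0 < i <= n -> u (i, value w i) = a i) ->
  (forall i, 0 < i <= n -> a i -> value w i = f i) ->
  filter u (entries (one_line w)) = zip (filter a (iota 1 n)) (map f (filter a (iota 1 n))).
Proof.
move=> eq_a eq_f; rewrite entries_one_line filter_map zip_map_graph.
rewrite (@eq_in_filter _ _ a); last first.
  by move=> i; rewrite mem_iota add1n ltnS => /eq_a.
apply/eq_in_map => i; rewrite mem_filter mem_iota add1n ltnS => /andP[ai le_i].
by rewrite eq_f.
Qed.

Lemma zip_rcons_l (S T : Type) (s : seq S) (t : seq T) x :
  size s = size t -> zip (rcons s x) t = zip s t.
Proof. by elim: s t => [|y s IH] [|z t] //= [/IH->]. Qed.

Lemma zip_rcons_r (S T : Type) (s : seq S) (t : seq T) x :
  size s = size t -> zip s (rcons t x) = zip s t.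
Proof. by elim: s t => [|y s IH] [|z t] //= [/IH->]. Qed.

Lemma shifted_step_word n (OB OC : seq nat) :
  step_word n (map S OB) OC = shifted_word n OB (map S OC).
Proof.
rewrite /step_word /shifted_word; congr (_ ++ rev _).
  rewrite (iotaS 0) -map_comp; apply: eq_map => i /=; rewrite mem_map //; exact: succn_inj.
rewrite (iotaS 1) -map_comp; apply: eq_map => i /=; rewrite mem_map //; exact: succn_inj.
Qed.

(** Raising positions on one side and values on the other gives the same lists;
    [greedy] is not affected by either. *)
Lemma greedy_shift (as_ bs cs ds : seq nat) :
  let M := greedy (zip as_ (map S bs)) (zip cs (map S ds)) in
  let M' := greedy (zip (map S as_) bs) (zip (map S cs) ds) in
  bumped M = map S (bumped M') /\ map S (bumping M) = bumping M'.
Proof.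
move=> M M'; pose f (x : entry) : entry := (x.1.+1, x.2).
pose g (x : entry) : entry := (x.1, x.2.+1).
have fg (s t : seq nat) : map f (zip s (map S t)) = map g (zip (map S s) t).
  by elim: s t => [|x s IH] [|y t] //=; rewrite IH.
have eq_M : [seq (f m.1, f m.2) | m <- M] = [seq (g m.1, g m.2) | m <- M'].
  rewrite -(@greedy_map S id) // -(@greedy_map id S) //.
  by rewrite -/f -/g !fg.
split.
  have := congr1 (map (fun m : entry * entry => m.1.2)) eq_M.
  by rewrite /bumped -!map_comp.
have := congr1 (map (fun m : entry * entry => m.2.1)) eq_M.
by rewrite /bumping -!map_comp.
Qed.

(** The uppers and lowers of the two permutations are brought to the form of
    [greedy_one_flip] with [a = 1] and [d = 0]: the weak excedances of [w] start
    at position 1 and end with the value n, and the values of the lowers of [w']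
    are determined as the complement of those of its uppers. *)
Lemma RSK_rowmotion_form n (p : dyck n.+1) (w w' : {perm 'I_n.+1}) :
  avoids321 w -> is_path_of_perm w p ->
  avoids321 w' -> is_path_of_perm w' (rowmotion p) ->
  promotion_form (RSK_steps (one_line w)) (RSK_steps (one_line w')).
Proof.
move=> av pw av' pw'; have ok := weak_shuffle av; have ok' := strict_shuffle av'.
have dy := RSK_steps_dyck av; move: dy.
rewrite (RSK_steps_greedy (perm_one_line w) ok) (RSK_steps_greedy (perm_one_line w') ok').
rewrite /greedy_split.
pose h := height p.
pose as_ := filter (is_valley n.+1 h) (iota 1 n.+1).
pose cs0 := filter (predC (rises h)) (iota 1 n.+1).
pose bs0 := map h as_; pose ds := map (value w) cs0.
have h_n : h n.+1 = n.+1.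
  by apply/eqP; rewrite eqn_leq height_le height_gt.
have def_bs : map h (filter (rises h) (iota 1 n.+1)) = rcons bs0 n.+1.
  by rewrite heights_of_rises // -/h h_n /bs0 /as_ (@filter_valleys id) cats0.
have us_eq : filter weak_exc (entries (one_line w)) =
    zip (1 :: map S as_) (rcons bs0 n.+1).
  rewrite -def_bs -filter_rises; apply: filter_entries => i le_i.
    by have [] := excedance_height pw le_i.
  by have [e1 e2] := excedance_height pw le_i; rewrite /rises -e1.
have ls_eq : filter (predC weak_exc) (entries (one_line w)) = zip cs0 ds.
  apply: filter_entries => // i le_i.
  by have [e1 _] := excedance_height pw le_i; rewrite /= /weak_exc /= e1.
have us'_eq : filter strict_exc (entries (one_line w')) = zip as_ (map S bs0).
  rewrite /bs0 -map_comp; apply: filter_entries => i le_i.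
    have [e1 e2] := excedance_height pw' le_i; have [<- _] := rowmotion_peak p le_i.
    rewrite /strict_exc /= -e1; case: (leqP i (value w' i)) => [le_v|lt_v].
      by rewrite -e2.
    by rewrite ltnNge ltnW.
  have [e1 e2] := excedance_height pw' le_i; have [e3 e4] := rowmotion_peak p le_i.
  move=> val_i; rewrite /= -/h -e4 // e2 // e1.
  by move: val_i; rewrite -e3 => /andP[].
have ls'_eq : filter (predC strict_exc) (entries (one_line w')) =
    zip (filter (predC (is_valley n.+1 h)) (iota 1 n.+1))
        (map (value w') (filter (predC (is_valley n.+1 h)) (iota 1 n.+1))).
  apply: filter_entries => // i le_i /=.
  have [e1 e2] := excedance_height pw' le_i; have [<- _] := rowmotion_peak p le_i.
  rewrite /strict_exc /= -e1; case: (leqP i (value w' i)) => [le_v|lt_v].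
    by rewrite -e2.
  by rewrite ltnNge ltnW.
have [us_s ls_s] := sorted_shuffle ok; have [_ ls'_s] := sorted_shuffle ok'.
have [perm1 perm2] := perm_split weak_exc w; have [_ perm2'] := perm_split strict_exc w'.
have sz_bs0 : size bs0 = size as_ by rewrite size_map.
have sz_ds : size ds = size cs0 by rewrite size_map.
move: perm1 perm2 perm2' us_s ls_s ls'_s; rewrite us_eq ls_eq us'_eq ls'_eq.
set cs' := filter (predC (is_valley n.+1 h)) (iota 1 n.+1).
set ds' := map (value w') cs'.
have sz_ds' : size ds' = size cs' by rewrite size_map.
have sz_us : size (1 :: map S as_) = size (rcons bs0 n.+1).
  by rewrite size_rcons /= !size_map.
rewrite !unzip1_zip ?unzip2_zip ?sz_us ?sz_ds ?sz_ds' ?size_map //.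
move=> perm1 perm2 perm2' bs_s ds_s ds'_s.
have as_s : sorted ltn (1 :: map S as_).
  by rewrite -filter_rises; apply: (sorted_filter ltn_trans); apply: iota_ltn_sorted.
have cs_s : sorted ltn (rcons cs0 n.+2).
  rewrite filter_not_rises sorted_map; apply: (@sub_sorted _ ltn) => //.
  by apply: (sorted_filter ltn_trans); apply: iota_ltn_sorted.
have ds_gt0 : all (ltn 0) ds.
  apply/allP=> d d_ds; have /andP[] // : 0 < d <= n.+1.
  by apply: (perm_iota_range perm2); rewrite mem_cat d_ds orbT.
have ds'E : ds' = map S (0 :: ds).
  apply: (irr_sorted_eq ltn_trans ltnn) => //.
    rewrite sorted_map; apply: (@sub_sorted _ ltn) => //=.
    by rewrite (path_sortedE ltn_trans) ds_gt0.
  apply: perm_mem; rewrite -(perm_cat2l (map S bs0)) (perm_trans perm2') //.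
  rewrite -map_cat (iotaS 0); apply: perm_map; apply/seq.permP=> a.
  have /seq.permP/(_ a) := perm2.
  have -> : iota 0 n.+1 = 0 :: iota 1 n by [].
  rewrite iota_rcons -!cats1 !count_cat [count a [:: _]]/= [count a (0 :: _)]/= [count a (0 :: ds)]/=.
  move: (a 0) (a n.+1) (count a bs0) (count a ds) (count a (iota 1 n)).
  by clear=> x y b d i; lia.
have [eq_B eq_C] := @greedy_shift as_ bs0 cs' (0 :: ds).
move: eq_B eq_C; rewrite -ds'E -filter_not_rises -/cs0 => eq_B eq_C.
rewrite eq_B shifted_step_word eq_C.
have us_ext : zip (map S as_) bs0 = zip (map S as_) (rcons bs0 n.+1).
  by rewrite zip_rcons_r // !size_map.
have ls_ext : zip cs0 ds = zip (rcons cs0 n.+2) ds by rewrite zip_rcons_l.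
rewrite us_ext ls_ext => dy.
have subB ls : subseq (bumped (greedy (zip (map S as_) (rcons bs0 n.+1)) ls)) bs0.
  rewrite -us_ext /bumped (map_comp snd fst).
  apply: subseq_trans (map_subseq snd (subseq_greedy1 _ _)) _.
  by rewrite -/(unzip2 _) unzip2_zip ?size_map.
have subC us : subseq (bumping (greedy us (zip (rcons cs0 n.+2) ds))) cs0.
  rewrite -ls_ext /bumping (map_comp fst snd).
  apply: subseq_trans (map_subseq fst (subseq_greedy2 _ _)) _.
  by rewrite -/(unzip1 _) unzip1_zip ?size_map.
have leq_s s : sorted ltn s -> sorted leq s.
  by apply: sub_sorted => x y /ltnW.
apply: (@one_flip_form n.+1 (map S as_) (rcons bs0 n.+1) (rcons cs0 n.+2) ds) => //.
- apply: greedy_one_flip => //.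
  + by rewrite size_rcons !size_map.
  + by rewrite last_rcons.
  + by rewrite last_rcons.
  + exact: leq_s.
  + exact: leq_s.
  + by apply: leq_s; apply: path_sorted as_s.
  + exact: leq_s.
  + apply/allP=> d d_ds; have /andP[] // : 0 < d <= n.+1.
    by apply: (perm_iota_range perm2); rewrite mem_cat d_ds orbT.
  + apply/allP=> a a_as; have /andP[_ /leqW] // : 0 < a <= n.+1.
    by apply: (perm_iota_range perm1); rewrite mem_cat inE a_as orbT.
  + move=> x y; rewrite -us_ext -ls_ext .
    rewrite /bs0 /ds (zip_map S) zip_map_graph => /mapP[i i_as ->] /mapP[c c_cs ->] /=.
    have [le_ci|] := leqP c i; last by left.
    right; move: c_cs; rewrite mem_filter mem_iota add1n ltnS => /andP[/= not_rise le_c].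
    have [e1 _] := excedance_height pw le_c.
    move: not_rise; rewrite /rises -e1 -ltnNge => /ltnW/leq_trans; apply.
    apply: leq_trans le_ci _; move: i_as; rewrite mem_filter mem_iota add1n ltnS.
    by case/andP=> _ /andP[i_gt0 le_in]; rewrite -(prednK i_gt0) height_gt // prednK.
  + case def_cs: cs0 => [|c cs1] //=; have : c \in cs0 by rewrite def_cs mem_head.
    by rewrite mem_filter mem_iota => /and3P[].
- by rewrite last_rcons.
- by rewrite last_rcons.
- apply/seq.permP=> a; have /seq.permP/(_ a) := perm1.
  rewrite (iota_rcons 1 n.+1) -!cats1 !count_cat => <-.
  by rewrite addnAC [in LHS]addnC -addnA [in LHS]addnC -addnA addnCA addnA.
- exact: subseq_trans (subB _) (subseq_rcons _ _).
- apply/negP=> /(mem_subseq (subB _)) n_bs0.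
  have : uniq (rcons bs0 n.+1) by apply: sorted_uniq bs_s => //; [exact: ltn_trans | exact: ltnn].
  by rewrite rcons_uniq n_bs0.
- exact: subseq_trans (subC _) (subseq_rcons _ _).
- apply/negP=> /(mem_subseq (subC _)); rewrite mem_filter mem_iota add1n => /andP[_ /andP[_]].
  by rewrite ltnn.
Qed.

(** Neither default value in the definition of [RSKhat] is taken. *)
Lemma RSKhat_spec n (p : dyck n) :
  exists2 w : {perm 'I_n}, avoids321 w && is_path_of_perm w p &
    RSKhat p = RSK_steps (one_line w) :> seq bool.
Proof.
rewrite /RSKhat; case: pickP => [w /andP[av pw]|no_w].
  exists w; first by rewrite av.
  by rewrite val_insubd /= (RSK_steps_dyck av).
by have [w] := exists_perm_of_path p; rewrite no_w.
Qed.

Theorem proposition5p13 (n : nat) (hn : 1 <= n) :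
  @RSKhat n \o @rowmotion n =1 invF (@promotion_inj n) \o @RSKhat n.
Proof.
case: n hn => // n _ p /=.
apply: (canRL (invF_f _)); rewrite -/(promotion _).
have [w /andP[av pw] def_q] := RSKhat_spec p.
have [w' /andP[av' pw'] def_q'] := RSKhat_spec (rowmotion p).
have [al [ga [def_w' def_w bal]]] := RSK_rowmotion_form av pw av' pw'.
by apply: (promotion_word _ _ bal); rewrite ?def_q ?def_q'; [exact: def_w'|exact: def_w].
Qed.
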